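(* Let $G\cong \mathbb{Z}_{a_1}\oplus\mathbb{Z}_{a_1a_2}\oplus\mathbb{Z}_{a_1a_2a_3}$, where $a_1,a_2,a_3$ are positive integers. Then $$D(G)\le a_1a_2a_3+a_1a_2+Ka_1,$$ where $K$ is a constant of the same order of magnitude as that of Alon-Dubiner.
   Context: $\mathbb{Z}_n$ denotes the cyclic group of order $n$. For a finite abelian group $G$ (written additively), a sequence of elements of $G$ (not necessarily distinct) is a zero-sum sequence if the sum of its terms is $0$. The Davenport constant $D(G)$ is the smallest integer $d$ such that every sequence of $d$ elements of $G$ contains a (nonempty) zero-sum subsequence. For a positive integer $s$, $D^s(G)$ denotes the smallest integer $t$ such that every sequence of $t$ elements of $G$ contains a (nonempty) zero-sum subsequence of length at most $s$. Alon and Dubiner proved that $D^p(\mathbb{Z}_p^r)\le c(r)p$ for every prime $p$, where $c(r)$ is a constant depending only on $r$, which can be taken to be $(cr\log r)^r$ with $c$ an absolute constant. The Alon-Dubiner constant referred to in the claim is this constant in the case $r=3$. *)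

(* Defs.v *)
From mathcomp Require Import all_boot all_order all_algebra all_fingroup.
From mathcomp Require Import reals.
Set Implicit Arguments.
Unset Strict Implicit.
Unset Printing Implicit Defensive.
Import Order.TTheory GRing.Theory Num.Theory.
Local Open Scope ring_scope.

(* A sequence of t elements of G is a map x : 'I_t -> G, and its nonempty
   subsequences are indexed by the nonempty sets I of positions. *)
Definition zero_sum_at (G : finZmodType) (t : nat) (x : {ffun 'I_t -> G})
    (I : {set 'I_t}) : bool :=
  (I != set0) && (\sum_(i in I) x i == 0).

Definition forces_zero_sum (G : finZmodType) (d : nat) : bool :=
  [forall x : {ffun 'I_d -> G}, [exists I : {set 'I_d}, zero_sum_at x I]].

Definition forces_short_zero_sum (G : finZmodType) (s t : nat) : bool :=
  [forall x : {ffun 'I_t -> G},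
    [exists I : {set 'I_t}, zero_sum_at x I && (#|I| <= s)%N]].

(* Pigeonhole on the #|G| + 1 partial sums of a sequence of length #|G|. *)
Lemma forces_zero_sum_card (G : finZmodType) : forces_zero_sum G #|G|.
Proof.
apply/forallP => x; apply/existsP.
pose S (j : 'I_#|G|.+1) := \sum_(i < #|G| | (i < j)%N) x i.
have /injectivePn[j [k neq_jk eqS]] : ~~ injectiveb S.
  apply/negP => /injectiveP injS.
  by have := leq_card S injS; rewrite card_ord ltnn.
wlog lt_jk : j k neq_jk eqS / (j < k)%N.
  move=> wlt; case: (ltngtP j k) => [|lt_kj|/val_inj eq_jk].
  - exact: wlt.
  - by apply: (wlt k j) => //; rewrite eq_sym.
  - by rewrite eq_jk eqxx in neq_jk.
exists [set i : 'I_#|G| | (j <= i < k)%N]; apply/andP; split.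
  have lt_j : (j < #|G|)%N by rewrite (leq_trans lt_jk) // -ltnS.
  by apply/set0Pn; exists (Ordinal lt_j); rewrite inE /= leqnn.
suff : S k = S j + \sum_(i in [set i : 'I_#|G| | (j <= i < k)%N]) x i.
  by rewrite -eqS -[LHS]addr0 => /addrI <-.
rewrite /S (bigID (fun i : 'I_#|G| => (i < j)%N)) /=; congr (_ + _).
  apply: eq_bigl => i; case: (ltnP i j) => [lt_ij|]; last by rewrite andbF.
  by rewrite (ltn_trans lt_ij lt_jk).
by apply: eq_bigl => i; rewrite inE -leqNgt andbC.
Qed.

Definition davenport (G : finZmodType) : nat :=
  ex_minn (ex_intro (forces_zero_sum G) #|G| (forces_zero_sum_card G)).

(* D^s(G) = t, as a relation: when s is smaller than the exponent of G, no t
   forces a zero-sum subsequence of length at most s. *)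
Definition is_short_davenport (s : nat) (G : finZmodType) (t : nat) : Prop :=
  forces_short_zero_sum G s t /\
  forall u, forces_short_zero_sum G s u -> (t <= u)%N.

(* c can serve as the constant c(r) of Alon and Dubiner: D^p(Z_p^r) <= c p for
   every prime p. *)
Definition alon_dubiner_constant (R : realType) (r : nat) (c : R) : Prop :=
  forall p : nat, prime p ->
    exists2 t : nat, is_short_davenport p 'rV['F_p]_r t & t%:R <= c * p%:R.

(* G is isomorphic to Z_a (+) Z_b (+) Z_c.  Here Zp n is cyclic of order n for
   every n > 0; the full type 'Z_n would have two elements when n = 1. *)
Definition isog_cyclic3 (G : finZmodType) (a b c : nat) : bool :=
  [set: G] \isog setX (setX (Zp a) (Zp b)) (Zp c).

(* Main.v *)
Require Import Defs.
From mathcomp Require Import all_boot all_order all_algebra all_fingroup.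
From mathcomp Require Import reals.
From mathcomp Require Import finfield zify ring lra.
Set Implicit Arguments.
Unset Strict Implicit.
Unset Printing Implicit Defensive.
Import Order.TTheory GRing.Theory Num.Theory.
Local Open Scope ring_scope.

(** The bound is Olson's inductive method.  Write n = a1 and G = Z_n + Z_(n a2) + Z_(n a2 a3).
    The quotient G / nG is Z_n^3 and nG is Z_a2 + Z_(a2 a3), whose Davenport
    constant is a2 + a2 a3 - 1.  In a long sequence of elements of G one finds
    disjoint blocks of at most n terms whose sum lies in nG, as long as some
    constant times n terms remain; a2 + a2 a3 - 1 such blocks have block sums
    that contain a zero-sum subsequence, and they use at most
    n a2 a3 + n a2 + O(n) terms ([forces_int_rank3]).  Group elements are
    represented by vectors of integers read modulo the orders of the cyclic
    factors, so that passing to the subgroup nG is exact division by n.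

    Two facts feed this.  First, D(Z_n + Z_(n m)) <= n + n m - 1
    ([forces_int_rank2]), by the same method from the prime case.  Second, any
    C n elements of Z_n^3 contain a zero-sum subsequence of length at most n
    ([forces_short_int_cube]); this reduces to prime n, with a loss in the
    constant that is a convergent geometric series.  The prime case is the
    Alon-Dubiner theorem in dimension 3, [short_zero_sum_Fp3], which carries the
    weight of the file.  Since every admissible Alon-Dubiner constant c is at
    least 1/2, a bound with an absolute constant is a bound of order c.

    The Alon-Dubiner theorem is proved by a dichotomy.  If more than 4p terms lie
    on one affine plane of F_p^3, the problem is two-dimensional and Ronyai's
    polynomial argument ([egz_plane]) gives p terms with sum zero.  Otherwise the
    sequence is spread out, and one builds two disjoint sets of fewer than p/2
    terms, each with more than p^3/2 subset sums; then every element, in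
    particular the opposite of a further term, is a sum of two such subset sums.
    The set Y of subset sums is grown greedily: adding the term g enlarges it by
    bdry Y g, the number of y in Y with y + g outside Y.  The function bdry Y is
    subadditive, so a single term has a large boundary as soon as some short sum
    of terms has one.
    - While Y is small, a box spanned by three independent terms contains such a
      sum ([base_expansion]); the size of Y then grows like the cube of the number
      of terms used, up to a small positive proportion of p^3.
    - After that, [expansion] provides a term whose boundary is at least a
      constant times (V / p) |Y|, where V is as large as desired, so that each
      doubling of Y costs only O(p / V) terms.  The proof decomposes the
      centred indicator of Y into its sums along parallel planes, one family
      for each normal vector u ([radon_energy]).  In each family one has a
      function h of mean zero on F_p.  If h were almost fixed by all multiples
      up to p/V of more than O(V^3) elements, then two of these elements would
      have a ratio that is not a quotient of small integers, and by Dirichlet's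
      approximation argument every element of F_p would be a sum of two such
      multiples ([two_progressions]), contradicting mean zero.  As the terms are
      spread, at least half of them have a multiple that moves h. *)

(** * Functions of bounded degree on subsets *)

(** A function of T is of degree at most k when it is a multilinear polynomial of degree
    at most k in the 0-1 indicator variables of T; the coefficient of the monomial
    attached to U is c U. *)
Definition setdeg (R : comNzRingType) (I : finType) (k : nat) (F : {set I} -> R) : Prop :=
  exists c : {set I} -> R,
    forall T, F T = \sum_(U : {set I} | (U \subset T) && (#|U| <= k)%N) c U.

Lemma setdeg_ext (R : comNzRingType) (I : finType) (k : nat) (F G : {set I} -> R) :
  F =1 G -> setdeg k F -> setdeg k G.
Proof. by move=> eFG [c hc]; exists c => T; rewrite -eFG. Qed.

Lemma setdeg_const (R : comNzRingType) (I : finType) (k : nat) (a : R) :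
  setdeg k (fun _ : {set I} => a).
Proof.
exists (fun U => if U == set0 then a else 0) => T.
rewrite -big_mkcondr (big_pred1 set0) => [|U] /=; first by [].
by case: eqVneq => [->|]; rewrite ?sub0set ?cards0 ?andbF.
Qed.

Lemma setdegD (R : comNzRingType) (I : finType) (k : nat) (F G : {set I} -> R) :
  setdeg k F -> setdeg k G -> setdeg k (fun T => F T + G T).
Proof.
move=> [c hc] [d hd]; exists (fun U => c U + d U) => T.
by rewrite hc hd big_split.
Qed.

(** The monomials of U and V multiply to the monomial of the union of U and V, which is
    why degrees add although the polynomials are kept multilinear. *)
Lemma setdegM (R : comNzRingType) (I : finType) (k l : nat) (F G : {set I} -> R) :
  setdeg k F -> setdeg l G -> setdeg (k + l) (fun T => F T * G T).
Proof.
move=> [c hc] [d hd].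
exists (fun W => \sum_(q : {set I} * {set I} |
  [&& (#|q.1| <= k)%N, (#|q.2| <= l)%N & q.1 :|: q.2 == W]) c q.1 * d q.2) => T.
rewrite hc hd big_distrlr /= pair_big_dep /=.
rewrite (partition_big (fun q : {set I} * {set I} => q.1 :|: q.2)
  (fun W => (W \subset T) && (#|W| <= k + l)%N)) /=; last first.
  move=> [U V] /= /andP[/andP[UT Uk] /andP[VT Vl]].
  by rewrite subUset UT VT /= (leq_trans (leq_card_setU U V)) ?leq_add.
apply: eq_bigr => W /andP[WT _]; apply: eq_bigl => -[U V] /=.
case: (eqVneq (U :|: V) W) => [e|]; last by rewrite !andbF.
move: WT; rewrite -e subUset => /andP[-> ->] /=.
by rewrite !andbT.
Qed.

Lemma setdegX (R : comNzRingType) (I : finType) (k n : nat) (F : {set I} -> R) :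
  setdeg k F -> setdeg (n * k) (fun T => F T ^+ n).
Proof.
move=> hF; elim: n => [|n IH]; first exact: setdeg_const.
by rewrite mulSn; apply: setdeg_ext (setdegM hF IH) => T; rewrite exprS.
Qed.

Lemma setdeg_sum (R : comNzRingType) (I : finType) (a : I -> R) :
  setdeg 1 (fun T : {set I} => \sum_(i in T) a i).
Proof.
exists (fun U => \sum_(i | U == [set i]) a i) => T.
rewrite (exchange_big_dep (fun i => i \in T)) /=; last first.
  by move=> U i /andP[UT _] /eqP e; rewrite -sub1set -e.
apply: eq_bigr => i iT; rewrite (big_pred1 [set i]) // => U /=.
by case: eqVneq => [->|]; rewrite ?sub1set ?cards1 ?iT ?andbF.
Qed.

(** The binomial coefficient is the elementary symmetric polynomial of degree k in the
    indicator variables, so its degree is k also when k! vanishes in R. *)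
Lemma setdeg_bin (R : comNzRingType) (I : finType) (k : nat) :
  setdeg k (fun T : {set I} => ('C(#|T|, k))%:R : R).
Proof.
exists (fun U : {set I} => (#|U| == k)%:R) => T.
under eq_bigr => U _ do rewrite mulrb.
rewrite -big_mkcondr -cards_draws /= sumr_const; congr (_ *+ _).
apply: eq_card => U; rewrite !inE unfold_in.
by case: eqVneq => [->|]; rewrite ?leqnn ?andbT ?andbF.
Qed.

(** This plays the part of the Chevalley-Warning theorem: the alternating sum over the
    subsets of S extracts the coefficient of the full monomial of S, which a polynomial
    of degree less than |S| does not have.  A monomial U misses some s in S, and adding or
    removing s pairs off the terms. *)
Lemma alternating_sum0 (R : comNzRingType) (I : finType) (k : nat) (F : {set I} -> R)
    (S : {set I}) :
  setdeg k F -> (k < #|S|)%N ->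
  \sum_(T : {set I} | T \subset S) (-1) ^+ #|T| * F T = 0.
Proof.
move=> [c hc] kS.
under eq_bigr => T _ do rewrite hc mulr_sumr.
rewrite (exchange_big_dep (fun U : {set I} => (#|U| <= k)%N)) /=; last first.
  by move=> T U _ /andP[].
rewrite big1 // => U Uk.
have [s sS sU] : exists2 s, s \in S & s \notin U.
  apply/subsetPn; apply/negP => /subset_leq_card.
  by rewrite leqNgt (leq_ltn_trans Uk kS).
rewrite (bigID (fun T : {set I} => s \in T)) /=.
rewrite (reindex_onto (fun T : {set I} => s |: T) (fun T => T :\ s)) /=; last first.
  by move=> T /andP[_ sT]; rewrite setD1K.
rewrite -[X in _ + X]opprK -sumrN; apply/eqP; rewrite subr_eq0; apply/eqP.
apply: eq_big => [T|T].
  rewrite Uk !andbT setU11 andbT subUset sub1set sS /=.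
  case: (boolP (s \in T)) => sT.
    rewrite andbF; apply/negbTE; rewrite negb_and; apply/orP; right.
    apply/eqP => e; move: sT; rewrite -e !inE eqxx //.
  rewrite setU1K // eqxx !andbT; congr (_ && _).
  apply/subsetP/subsetP => h x xU; have := h x xU; rewrite !inE; last by move->; rewrite orbT.
  by case/orP => // /eqP e; move: sU; rewrite -e xU.
move=> /andP[_ /eqP e].
have sT : s \notin T by rewrite -e !inE eqxx.
by rewrite cardsU1 sT /= exprS mulN1r mulNr.
Qed.

(** * Zero-sum subsequences over F_p by the Chevalley-Warning method *)

Lemma subset_of_card (I : finType) (S : {set I}) (n : nat) :
  (n <= #|S|)%N -> exists2 T : {set I}, T \subset S & #|T| = n.
Proof.
move=> /card_geqP[s [us <- sS]]; exists [set x in s].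
  by apply/subsetP => x; rewrite inE => /sS.
by rewrite -(card_uniqP us); apply: eq_card => x; rewrite inE.
Qed.

Lemma Fp_expf_pred (p : nat) (x : 'F_p) : prime p -> x != 0 -> x ^+ p.-1 = 1.
Proof.
move=> pp x0; apply: (mulfI x0); rewrite -exprS mulr1 prednK ?prime_gt0 //.
by have := expf_card x; rewrite card_Fp.
Qed.

Lemma natr_Fp_eq0 (p n : nat) : prime p -> ((n%:R : 'F_p) == 0) = (p %| n)%N.
Proof. by move=> pp; rewrite (dvdn_pcharf (pchar_Fp pp)). Qed.

Lemma setdeg_prod (R : comNzRingType) (I J : finType) (k : nat) (F : J -> {set I} -> R) :
  (forall j, setdeg k (F j)) -> setdeg (#|J| * k) (fun T => \prod_j F j T).
Proof.
move=> hF; rewrite cardT enumT -[Finite.enum J]/(index_enum J).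
elim: (index_enum J) => [|j r IH] /=.
  by apply: setdeg_ext (setdeg_const I 0 1) => T; rewrite big_nil.
by rewrite mulSn; apply: setdeg_ext (setdegM (hF j) IH) => T; rewrite big_cons.
Qed.

(** The product of the factors 1 - (sum)^(p-1) is the indicator of the common zero-sum
    condition, by Fermat.  If the empty set were the only zero-sum subset on which Q does
    not vanish, the alternating sum would be Q set0. *)
Lemma chevalley_subsums (p : nat) (I J : finType) (v : J -> I -> 'F_p) (S : {set I})
    (k : nat) (Q : {set I} -> 'F_p) :
  prime p -> setdeg k Q -> Q set0 != 0 -> (#|J| * p.-1 + k < #|S|)%N ->
  exists T : {set I},
    [/\ T \subset S, T != set0, forall j, \sum_(i in T) v j i = 0 & Q T != 0].
Proof.
move=> pp hQ Q0 hS.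
pose F (T : {set I}) := (\prod_j (1 + (-1) * (\sum_(i in T) v j i) ^+ p.-1)) * Q T.
have hF : setdeg (#|J| * p.-1 + k) F.
  apply: setdegM hQ; apply: setdeg_prod => j.
  apply: setdegD; first exact: setdeg_const.
  rewrite -[p.-1]add0n; apply: setdegM; first exact: setdeg_const.
  by rewrite add0n -[X in setdeg X]muln1; apply: setdegX; apply: setdeg_sum.
have FP T : F T != 0 -> (forall j, \sum_(i in T) v j i = 0) /\ Q T != 0.
  rewrite /F mulf_eq0 negb_or => /andP[/prodf_neq0 h ->]; split=> // j.
  apply/eqP; apply: contraT => vj; have := h j isT.
  by rewrite Fp_expf_pred // mulr1 subrr eqxx.
have F0 : F set0 != 0.
  rewrite /F mulf_neq0 //; apply/prodf_neq0 => j _.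
  have p1 : (0 < p.-1)%N by rewrite -subn1 subn_gt0 prime_gt1.
  by rewrite big_set0 expr0n gtn_eqF // mulr0 addr0 oner_neq0.
have := alternating_sum0 hF hS; rewrite (bigD1 set0) ?sub0set //=.
case: (pickP (fun T : {set I} => [&& T \subset S, T != set0 & F T != 0])).
  by move=> T /and3P[TS T0 /FP[h1 h2]] _; exists T.
move=> h; rewrite big1; last first.
  move=> T /andP[TS T0]; have := h T; rewrite TS T0 /= => /negbFE/eqP ->.
  by rewrite mulr0.
by rewrite cards0 mul1r addr0 => e; rewrite e eqxx in F0.
Qed.

(** Olson's upper bound d (p - 1) + 1 for the Davenport constant of F_p^d. *)
Lemma davenport_Fp (p : nat) (I J : finType) (v : J -> I -> 'F_p) (S : {set I}) :
  prime p -> (#|J| * p.-1 < #|S|)%N ->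
  exists T : {set I},
    [/\ T \subset S, T != set0 & forall j, \sum_(i in T) v j i = 0].
Proof.
move=> pp hS; have [||T [TS T0 h _]] :=
  chevalley_subsums v (S := S) pp (setdeg_const I 0 (1 : 'F_p)).
- by rewrite oner_neq0.
- by rewrite addn0; apply: hS.
- by exists T.
Qed.

(** Adjoining a constant coordinate 1 to a plane vector makes zero-sum subsets have a
    length divisible by p. *)
Definition pair_and_length (p : nat) (I : Type) (x y : I -> 'F_p) (j : option bool) (i : I) :
  'F_p := match j with Some true => x i | Some false => y i | None => 1 end.

Lemma pair_and_lengthP (p : nat) (I : finType) (x y : I -> 'F_p) (T : {set I}) :
  prime p -> (forall j, \sum_(i in T) pair_and_length x y j i = 0) ->
  [/\ \sum_(i in T) x i = 0, \sum_(i in T) y i = 0 & (p %| #|T|)%N].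
Proof.
move=> pp h; split; [exact: (h (Some true))|exact: (h (Some false))|].
by rewrite -natr_Fp_eq0 //; apply/eqP; rewrite -[RHS](h None) /= sumr_const.
Qed.

Lemma setD_zero_sum (V : zmodType) (I : finType) (x : I -> V) (U T : {set I}) :
  U \subset T -> \sum_(i in T) x i = 0 -> \sum_(i in U) x i = 0 ->
  \sum_(i in T :\: U) x i = 0.
Proof.
by move=> UT hT hU; move: hT; rewrite (big_setID U) /= (setIidPr UT) hU add0r.
Qed.

Lemma davenport_plane (p : nat) (I : finType) (x y : I -> 'F_p) (S : {set I}) :
  prime p -> (2 * p <= #|S| + 1)%N ->
  exists T : {set I},
    [/\ T \subset S, T != set0, \sum_(i in T) x i = 0 & \sum_(i in T) y i = 0].
Proof.
move=> pp hS; have p1 := prime_gt1 pp.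
have [|T [TS T0 h]] := davenport_Fp (fun (b : bool) i => if b then x i else y i) (S := S) pp.
  by rewrite card_bool; lia.
by exists T; split=> //; [exact: (h true)|exact: (h false)].
Qed.

(** Lengths of zero-sum subsets are controlled modulo p through an extra coordinate; a
    zero-sum subset of length 2p is longer than the Davenport constant of the plane, hence
    splits into two zero-sum parts, one of length at most p. *)
Lemma eta_plane (p : nat) (I : finType) (x y : I -> 'F_p) (S : {set I}) :
  prime p -> (3 * p <= #|S| + 2)%N ->
  exists T : {set I}, [/\ T \subset S, T != set0, (#|T| <= p)%N,
    \sum_(i in T) x i = 0 & \sum_(i in T) y i = 0].
Proof.
move=> pp hS; have p1 := prime_gt1 pp.
have [|S' S'S cS'] := subset_of_card (S := S) (n := (3 * p - 2)%N); first by lia.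
have [|T [TS T0 /(pair_and_lengthP pp)[hx hy /dvdnP[k hk]]]] :=
  davenport_Fp (pair_and_length x y) (S := S') pp.
  by rewrite card_option card_bool cS'; lia.
have cT : (#|T| <= 3 * p - 2)%N by rewrite -cS' subset_leq_card.
have T0' : (0 < #|T|)%N by rewrite card_gt0.
have TS2 := subset_trans TS S'S.
case: (leqP #|T| p) => cTp; first by exists T.
(* The length k p of T lies strictly between p and 3p. *)
have k2 : k = 2 by nia.
have [t tT] := set0Pn _ T0.
have ct : (#|T :\ t|).+1 = #|T| by rewrite (cardsD1 t T) tT add1n.
have [|U [UT U0 hUx hUy]] := davenport_plane x y (S := T :\ t) pp; first by lia.
have UT' : U \subset T := subset_trans UT (subD1set _ _).
have cU : (#|U| <= #|T :\ t|)%N by apply: subset_leq_card.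
have cD : (#|T :\: U| + #|U| = #|T|)%N.
  by rewrite cardsD (setIidPr UT') subnK // subset_leq_card.
case: (leqP #|U| p) => cUp.
  by exists U; split=> //; apply: subset_trans TS2.
exists (T :\: U); split; try exact: setD_zero_sum.
- exact: subset_trans (subsetDl _ _) TS2.
- by rewrite -card_gt0; lia.
- by lia.
Qed.

Lemma split_3p (p : nat) (I : finType) (x y : I -> 'F_p) (T : {set I}) :
  prime p -> #|T| = (3 * p)%N -> \sum_(i in T) x i = 0 -> \sum_(i in T) y i = 0 ->
  exists U : {set I}, [/\ U \subset T, #|U| = p,
    \sum_(i in U) x i = 0 & \sum_(i in U) y i = 0].
Proof.
move=> pp cT hx hy; have p1 := prime_gt1 pp.
have [t tT] : exists t, t \in T by apply/set0Pn; rewrite -card_gt0; lia.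
have ct : (#|T :\ t|).+1 = #|T| by rewrite (cardsD1 t T) tT add1n.
have [|U [UT U0 /(pair_and_lengthP pp)[hUx hUy /dvdnP[k hk]]]] :=
  davenport_Fp (pair_and_length x y) (S := T :\ t) pp.
  by rewrite card_option card_bool; lia.
have UT' : U \subset T := subset_trans UT (subD1set _ _).
have cU : (#|U| <= #|T :\ t|)%N by apply: subset_leq_card.
have U0' : (0 < #|U|)%N by rewrite card_gt0.
have cD : (#|T :\: U| + #|U| = #|T|)%N.
  by rewrite cardsD (setIidPr UT') subnK // subset_leq_card.
have [k1|k2] : k = 1%N \/ k = 2 by nia.
  by exists U; split=> //; rewrite hk k1 mul1n.
exists (T :\: U); split; try exact: setD_zero_sum; first exact: subsetDl.
by lia.
Qed.

(** Vandermonde's identity: all inner terms are divisible by p. *)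
Lemma bin_2p_p (p : nat) : prime p -> ('C(2 * p, p)%:R : 'F_p) = 2%:R.
Proof.
move=> pp; have p1 := prime_gt1 pp.
case: p pp p1 => [|q] // pp p1.
rewrite mul2n -addnn -binomial.Vandermonde natr_sum big_ord_recl big_ord_recr /=.
rewrite big1 ?add0r => [|i _].
  by rewrite bin0 subn0 binn /= subnn bin0 addrC -natrD.
apply/eqP; rewrite natr_Fp_eq0 //; apply: dvdn_mulr; apply: prime_dvd_bin => //.
by rewrite /bump /=; have := ltn_ord i; lia.
Qed.

(** Ronyai's argument.  The extra polynomial factor C(|T|, p) - 2 vanishes modulo p when
    |T| = 2p, and is not zero at the empty set since p is odd.  What remains is a zero-sum
    subset of length p or 3p, and the latter contains one of length p. *)
Lemma egz_plane (p : nat) (I : finType) (x y : I -> 'F_p) (S : {set I}) :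
  prime p -> (2 < p)%N -> (4 * p <= #|S| + 2)%N ->
  exists T : {set I}, [/\ T \subset S, #|T| = p,
    \sum_(i in T) x i = 0 & \sum_(i in T) y i = 0].
Proof.
move=> pp p2 hS.
have [|S' S'S cS'] := subset_of_card (S := S) (n := (4 * p - 2)%N); first by lia.
have hQ := setdegD (setdeg_bin 'F_p I p) (setdeg_const I p (- 2%:R : 'F_p)).
have [||T [TS T0 /(pair_and_lengthP pp)[hx hy /dvdnP[k hk]] QT]] :=
  chevalley_subsums (pair_and_length x y) pp hQ (S := S').
- rewrite cards0 bin0n gtn_eqF ?prime_gt0 // add0r oppr_eq0 natr_Fp_eq0 //.
  by rewrite gtnNdvd.
- by rewrite card_option card_bool cS'; lia.
have cT : (#|T| <= 4 * p - 2)%N by rewrite -cS' subset_leq_card.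
have T0' : (0 < #|T|)%N by rewrite card_gt0.
have TS2 := subset_trans TS S'S.
have [k1|[k2|k3]] : k = 1%N \/ k = 2 \/ k = 3 by nia.
- by exists T; split=> //; rewrite hk k1 mul1n.
- by move: QT; rewrite hk k2 bin_2p_p // subrr eqxx.
- have [|U [UT cU hUx hUy]] := split_3p pp _ hx hy; first by rewrite hk k3.
  by exists U; split=> //; apply: subset_trans TS2.
Qed.

(** * Boundaries and sets of subset sums *)

(** The number of new elements gained when Y is replaced by the union of Y and Y + g. *)
Definition bdry (V : finZmodType) (Y : {set V}) (g : V) : nat :=
  #|[set y in Y | y + g \notin Y]|.

Lemma card_bdryC (V : finZmodType) (Y : {set V}) (g : V) :
  (#|[set y in Y | (y + g)%R \in Y]| + bdry Y g = #|Y|)%N.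
Proof.
rewrite -(cardsID [set y | y + g \in Y] Y); congr (_ + _)%N; apply: eq_card => y.
  by rewrite !inE.
by rewrite !inE andbC.
Qed.

Lemma bdryN (V : finZmodType) (Y : {set V}) (g : V) : bdry Y (- g) = bdry Y g.
Proof.
have /eqP := card_bdryC Y g; rewrite -(card_bdryC Y (- g)).
suff -> : #|[set y in Y | y + g \in Y]| = #|[set y in Y | y - g \in Y]|.
  by rewrite eqn_add2l => /eqP.
rewrite -(card_imset _ (addIr g)); apply: eq_card => z; rewrite !inE.
apply/imsetP/andP => [[y]|[zY zgY]].
  by rewrite inE => /andP[yY ygY] ->; rewrite addrK.
by exists (z - g); rewrite ?inE ?zgY subrK.
Qed.

Lemma bdryD (V : finZmodType) (Y : {set V}) (g h : V) :
  (bdry Y (g + h)%R <= bdry Y g + bdry Y h)%N.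
Proof.
have le_im : (#|[set y in Y | (y + g \in Y)%R && ((y + g + h)%R \notin Y)]| <= bdry Y h)%N.
  rewrite -(card_imset _ (addIr g)); apply: subset_leq_card.
  by apply/subsetP => z /imsetP[y]; rewrite !inE => /and3P[_ h1 h2] ->; rewrite h1.
apply: leq_trans (leq_add (leqnn _) le_im).
apply: leq_trans (leq_card_setU _ _); apply: subset_leq_card.
apply/subsetP => y; rewrite !inE addrA => /andP[-> ->].
by case: (y + g \in Y).
Qed.

Lemma bdry0 (V : finZmodType) (Y : {set V}) : bdry Y 0 = 0.
Proof.
apply/eqP; rewrite cards_eq0; apply/eqP/setP => y; rewrite !inE addr0.
by case: (y \in Y).
Qed.

Lemma bdryMn (V : finZmodType) (Y : {set V}) (g : V) (k : nat) :
  (bdry Y (g *+ k)%R <= k * bdry Y g)%N.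
Proof.
elim: k => [|k IH]; first by rewrite mulr0n bdry0.
by rewrite mulrS mulSn (leq_trans (bdryD _ _ _)) // leq_add2l.
Qed.

Lemma bdry_sum (V : finZmodType) (Y : {set V}) (J : finType) (g : J -> V) :
  (bdry Y (\sum_j g j)%R <= \sum_j bdry Y (g j))%N.
Proof.
apply: (big_ind2 (fun a b => bdry Y a <= b)%N) => //; first by rewrite bdry0.
move=> a b c d hab hcd; exact: leq_trans (bdryD _ _ _) (leq_add hab hcd).
Qed.

(** A random g in S moves a given y to a given place of Y with probability at most 1/|S|,
    so on average at most half of Y is mapped into Y. *)
Lemma bdry_average (V : finZmodType) (Y S : {set V}) :
  (0 < #|Y|)%N -> (2 * #|Y| <= #|S|)%N -> exists2 g, g \in S & (#|Y| <= 2 * bdry Y g)%N.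
Proof.
move=> Y0 YS; apply/exists_inP; apply/contraT => /exists_inPn /= hS.
have h1 : (\sum_(g in S) #|[set y in Y | (y + g)%R \in Y]| <= #|Y| * #|Y|)%N.
  under eq_bigr => g _ do rewrite -sum1_card.
  rewrite (exchange_big_dep (fun y => y \in Y)) /=; last by move=> g y _; rewrite inE => /andP[].
  rewrite -sum_nat_const; apply: leq_sum => y yY.
  rewrite sum1_card -(card_imset _ (addrI y)); apply: subset_leq_card.
  apply/subsetP => z /imsetP[g]; rewrite unfold_in => /andP[_].
  by rewrite inE => /andP[_ h] ->.
have h2 : (#|S| * #|Y|.+1 <= 2 * \sum_(g in S) #|[set y in Y | (y + g)%R \in Y]|)%N.
  rewrite -sum_nat_const big_distrr; apply: leq_sum => g gS /=.
  have aux a b c : (a + b = c -> ~~ (c <= 2 * b) -> c < 2 * a)%N by lia.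
  exact: aux (card_bdryC Y g) (hS g gS).
have aux y s t : (0 < y -> 2 * y <= s -> t <= y * y -> s * y.+1 <= 2 * t -> False)%N by nia.
by case: (aux _ _ _ Y0 YS h1 h2).
Qed.

Lemma sumset_cover (V : finZmodType) (A B : {set V}) (z : V) :
  (#|V| < #|A| + #|B|)%N -> exists a b, [/\ a \in A, b \in B & a + b = z].
Proof.
move=> h; have inj : injective (fun b : V => z - b) by move=> b c /addrI/oppr_inj.
have : ~~ [disjoint A & [set z - b | b in B]].
  apply/negP; rewrite -setI_eq0 => /eqP hd; rewrite -(card_imset B inj) in h.
  by move: h; rewrite ltnNge -cardsUI hd cards0 addn0 max_card.
case/pred0Pn => a /andP[/= aA /imsetP[b bB ab]].
by exists a, b; split=> //; rewrite ab subrK.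
Qed.

Definition subsums (V : finZmodType) (I : finType) (x : I -> V) (T : {set I}) : {set V} :=
  [set \sum_(i in U) x i | U : {set I} in powerset T].

Lemma subsumsP (V : finZmodType) (I : finType) (x : I -> V) (T : {set I}) (s : V) :
  reflect (exists2 U : {set I}, U \subset T & s = \sum_(i in U) x i) (s \in subsums x T).
Proof.
by apply: (iffP imsetP) => -[U hU ->]; exists U => //; move: hU; rewrite inE.
Qed.

Lemma card_subsumsU1 (V : finZmodType) (I : finType) (x : I -> V) (T : {set I}) (i : I) :
  i \notin T ->
  (#|subsums x T| + bdry (subsums x T) (x i) <= #|subsums x (i |: T)|)%N.
Proof.
move=> iT; rewrite /bdry -[X in (_ + X)%N](card_imset _ (addIr (x i))).
set Z := imset _ _.
have d : [disjoint subsums x T & Z].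
  apply/pred0P => s /=; apply/negP => /andP[sT /imsetP[y]].
  by rewrite inE => /andP[_ h] e; move: h; rewrite -e sT.
rewrite -(_ : #|subsums x T :|: Z| = #|subsums x T| + #|Z|)%N; last first.
  by apply/eqP; rewrite (leq_card_setU _ _).2.
apply: subset_leq_card; rewrite subUset; apply/andP; split; apply/subsetP => s.
  case/subsumsP => U UT ->; apply/subsumsP; exists U => //.
  by apply: subset_trans UT (subsetUr _ _).
case/imsetP => y; rewrite inE => /andP[/subsumsP[U UT ->] _] ->.
apply/subsumsP; exists (i |: U); first exact: setUS.
rewrite big_setU1 1?addrC //; apply: contra iT; exact: (subsetP UT).
Qed.

(** As long as the set of subset sums has fewer than B elements, a term whose boundary is
    at least w / D is available and is added.  The hypothesis is only asked of sets T' met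
    during the process, which are small and whose subset sums are at least as many as at the
    start. *)
Lemma greedy_growth (V : finZmodType) (I : finType) (x : I -> V) (S T : {set I})
    (D w B n : nat) :
  (0 < D)%N -> T \subset S ->
  (forall T' : {set I}, T' \subset S -> (#|T'| < #|T| + n)%N ->
     (#|subsums x T| <= #|subsums x T'|)%N -> (#|subsums x T'| < B)%N ->
     exists2 i, i \in S :\: T' & (w <= D * bdry (subsums x T') (x i))%N) ->
  exists T' : {set I}, [/\ T' \subset S, (#|T'| <= #|T| + n)%N &
    (B <= #|subsums x T'|)%N \/ (D * #|subsums x T| + n * w <= D * #|subsums x T'|)%N].
Proof.
move=> D0 TS.
suff gen m : (m <= n)%N -> (forall T' : {set I}, T' \subset S -> (#|T'| < #|T| + n)%N ->
     (#|subsums x T| <= #|subsums x T'|)%N -> (#|subsums x T'| < B)%N ->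
     exists2 i, i \in S :\: T' & (w <= D * bdry (subsums x T') (x i))%N) ->
    exists T' : {set I}, [/\ T' \subset S, (#|T'| <= #|T| + m)%N &
    (B <= #|subsums x T'|)%N \/ (D * #|subsums x T| + m * w <= D * #|subsums x T'|)%N].
  by move/(gen n (leqnn n)).
elim: m => [|m IH] mn step.
  by exists T; split=> //; [rewrite addn0|right; rewrite mul0n addn0].
have [T' [T'S cT' h]] := IH (ltnW mn) step.
case: (leqP B #|subsums x T'|) => hB; first by exists T'; split=> //; [lia|left].
have {}h : (D * #|subsums x T| + m * w <= D * #|subsums x T'|)%N by case: h; lia.
have [||i] := step T' T'S _ _ hB; [lia|by nia|].
rewrite inE => /andP[iT' iS] hi.
have := card_subsumsU1 x iT' => hc.
exists (i |: T'); split; first by rewrite subUset sub1set iS.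
  by rewrite cardsU1 iT'; lia.
by right; nia.
Qed.

(** * Functions on F_p that are almost fixed by many translations *)

(** The squared L2 distance between h and its translate by j.  Squares keep the values in
    an arbitrary ordered field; the price is the factor 2 in the triangle inequality. *)
Definition shift_dist (R : realFieldType) (V : finZmodType) (h : V -> R) (j : V) : R :=
  \sum_c (h c - h (c + j)) ^+ 2.

Lemma shift_dist_ge0 (R : realFieldType) (V : finZmodType) (h : V -> R) (j : V) :
  0 <= shift_dist h j.
Proof. by apply: sumr_ge0 => c _; apply: sqr_ge0. Qed.

Lemma shift_distN (R : realFieldType) (V : finZmodType) (h : V -> R) (j : V) :
  shift_dist h (- j) = shift_dist h j.
Proof.
rewrite /shift_dist (reindex_inj (addIr j)); apply: eq_bigr => c _.
by rewrite addrK -sqrrN opprB.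
Qed.

Lemma shift_distD (R : realFieldType) (V : finZmodType) (h : V -> R) (i j : V) :
  shift_dist h (i + j) <= 2 * (shift_dist h i + shift_dist h j).
Proof.
rewrite [shift_dist h j]/shift_dist (reindex_inj (addIr i)) -big_split mulr_sumr.
apply: ler_sum => c _ /=; rewrite addrA.
set a := h c; set b := h (c + i); set d := h (c + i + j).
have := sqr_ge0 (a - 2 * b + d); nra.
Qed.

(** For a function of mean zero the average squared distance to its translates is twice
    its squared norm, because the correlations with the translates sum to zero. *)
Lemma sum_shift_dist (R : realFieldType) (V : finZmodType) (h : V -> R) :
  \sum_c h c = 0 -> \sum_j shift_dist h j = 2 * #|V|%:R * \sum_c h c ^+ 2.
Proof.
move=> h0; rewrite exchange_big /=.
transitivity (\sum_c (#|V|%:R * h c ^+ 2 + \sum_b h b ^+ 2)).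
  apply: eq_bigr => c _; transitivity (\sum_b (h c - h b) ^+ 2).
    by rewrite [RHS](reindex_inj (addrI c)).
  under eq_bigr => b _ do rewrite sqrrB addrAC.
  rewrite big_split big_split /= sumr_const -[X in X + _ + _]mulr_natl.
  rewrite -[X in _ + X = _]opprK.
  rewrite -sumrN; under [X in _ - X]eq_bigr => b _ do rewrite opprK -mulrnAr mulr2n mulrDr.
  by rewrite big_split /= -mulr_sumr h0 mulr0 addr0 subr0.
rewrite big_split /= sumr_const -mulr_sumr -[X in _ + X]mulr_natl.
by rewrite -mulrA mulr2n mulrDl mul1r.
Qed.

Lemma ltn_Fp (p : nat) (z : 'F_p) : prime p -> (z < p)%N.
Proof. by move=> pp; have := ltn_ord z; rewrite [X in (_ < X)%N]Fp_cast. Qed.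

Lemma natr_Fp (p : nat) (z : 'F_p) : (z : nat)%:R = z.
Proof. exact: natr_Zp. Qed.

(** Dirichlet's approximation: among the V + 1 multiples t a with t <= V, two fall in the
    same interval of length p/V + 1. *)
Lemma dirichlet_Fp (p V : nat) (a : 'F_p) :
  prime p -> (0 < V)%N ->
  exists t r : nat, [/\ (0 < t <= V)%N, (r <= p %/ V)%N &
    t%:R * a = r%:R \/ t%:R * a = - r%:R].
Proof.
move=> pp V0; set M := (p %/ V).+1.
(* The value of t a in [0, p); its quotient by M is one of V intervals. *)
pose z (t : 'I_V.+1) : nat := (t%:R * a : 'F_p).
have zE (t : 'I_V.+1) : t%:R * a = (z t)%:R by rewrite natr_Fp.
have lt_z t : (z t %/ M < V)%N.
  rewrite ltn_divLR //; apply: leq_trans (ltn_Fp _ pp) _.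
  by rewrite /M mulnC; apply: ltnW; rewrite ltn_ceil.
have /injectivePn[t1 [t2 neq eqz]] : ~~ injectiveb (fun t => Ordinal (lt_z t)).
  apply/negP => /injectiveP inj.
  by have := leq_card _ inj; rewrite !card_ord ltnn.
wlog lt12 : t1 t2 neq eqz / (t1 < t2)%N.
  move=> W; case: (ltngtP t1 t2) => [|lt|/val_inj e]; [exact: W| |].
    by apply: (W t2 t1) => //; rewrite eq_sym.
  by rewrite e eqxx in neq.
have {eqz} eqz : (z t1 %/ M = z t2 %/ M)%N by case: eqz.
have close x y : (x %/ M = y %/ M -> x - y <= p %/ V)%N.
  move=> e; rewrite (divn_eq x M) (divn_eq y M) e subnDl.
  by rewrite (leq_trans (leq_subr _ _)) // -ltnS ltn_pmod.
have tt : ((t2 - t1)%N%:R * a = (z t2)%:R - (z t1)%:R).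
  by rewrite natrB ?(ltnW lt12) // mulrBl !zE.
have t2V := ltn_ord t2.
case: (leqP (z t1) (z t2)) => le12.
  exists (t2 - t1)%N, (z t2 - z t1)%N; split; [lia|exact: close|left].
  by rewrite tt natrB.
exists (t2 - t1)%N, (z t1 - z t2)%N; split; [lia|exact: close|right].
by rewrite tt natrB ?(ltnW le12) // opprB.
Qed.

(** The elements (+/-) r / t with r < V^2 and t <= V: those that are, up to bounded
    factors, rational numbers of small height. *)
Definition small_ratios (p V : nat) : {set 'F_p} :=
  [set (-1) ^+ (q.1.1 : bool) * (q.1.2%:R / q.2%:R) | q : bool * 'I_(V * V) * 'I_V.+1].

Lemma card_small_ratios (p V : nat) :
  (#|small_ratios p V| <= 2 * (V * V) * V.+1)%N.
Proof.
by apply: leq_trans (leq_imset_card _ _) _; rewrite !card_prod card_bool !card_ord.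
Qed.

(** Take t a = (+/-) r as in Dirichlet's approximation.  If a is not a ratio of small
    integers then r >= t V, so the multiples i t a with i t <= p/V go once around F_p in
    steps of length r <= p/V, and the multiples of 1 fill the gaps. *)
Lemma two_progressions (p V : nat) (a : 'F_p) :
  prime p -> (0 < V < p)%N -> a \notin small_ratios p V ->
  forall z : 'F_p, exists s i : nat,
    [/\ (s <= p %/ V)%N, (i <= p %/ V)%N & z = s%:R + i%:R * a \/ z = s%:R - i%:R * a].
Proof.
move=> pp /andP[V0 Vp] aS z.
have [t [r [/andP[t0 tV] rM tr]]] := dirichlet_Fp a pp V0.
have tn0 : t%:R != 0 :> 'F_p.
  by rewrite natr_Fp_eq0 // gtnNdvd // (leq_ltn_trans tV).
(* Otherwise a = (+/-) r / t would belong to small_ratios. *)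
have r_ge : (t * V <= r)%N.
  rewrite leqNgt; apply: contra aS => lt_r.
  have rVV : (r < V * V)%N by apply: leq_trans lt_r _; rewrite leq_mul2r tV orbT.
  have tV' : (t < V.+1)%N by [].
  apply/imsetP; case: tr => tr.
    exists (false, Ordinal rVV, Ordinal tV') => //=.
    by rewrite mul1r -tr mulrC mulKf.
  exists (true, Ordinal rVV, Ordinal tV') => //=.
  by rewrite mulN1r -mulNr -tr mulrC mulKf.
have r0 : (0 < r)%N by apply: leq_trans r_ge; rewrite muln_gt0 t0.
have zp := ltn_Fp z pp.
(* Division of z by the step r: the remainder is a multiple of 1, the quotient counts steps t a. *)
exists (z %% r)%N, (t * (z %/ r))%N; split.
- by apply: leq_trans rM; rewrite ltnW // ltn_pmod.
- rewrite leq_divRL //.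
  have h1 : (z %/ r * r <= z)%N := leq_trunc_div z r.
  have h2 : (t * (z %/ r) * V * 1 <= z %/ r * r)%N.
    by rewrite muln1 mulnAC mulnC leq_mul2l r_ge orbT.
  by lia.
- have zE : z = (z %% r)%N%:R + (z %/ r)%N%:R * r%:R.
    by rewrite -natrM -natrD addnC -divn_eq natr_Fp.
  case: tr => tr; [left|right]; rewrite {1}zE; congr (_ + _).
    by rewrite natrM mulrAC tr mulrC.
  by rewrite natrM mulrAC tr mulNr opprK mulrC.
Qed.

(** The elements j all of whose first M multiples translate h by less than half of its
    norm. *)
Definition nearly_fixed (R : realFieldType) (p : nat) (h : 'F_p -> R) (M : nat) :
  {set 'F_p} :=
  [set j | [forall k : 'I_M.+1, 4 * shift_dist h (j *+ k) < \sum_c h c ^+ 2]].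

(** If j / j0 is not a ratio of small integers for two such elements, every z is a sum
    of a short multiple of each, hence moves h by a squared distance at most its squared
    norm; but the average of this squared distance is twice the squared norm. *)
Lemma card_nearly_fixed (R : realFieldType) (p V : nat) (h : 'F_p -> R) :
  prime p -> (0 < V < p)%N -> \sum_c h c = 0 ->
  (#|nearly_fixed h (p %/ V)| <= 2 * (V * V) * V.+1 + 1)%N.
Proof.
move=> pp hV h0; set J := nearly_fixed _ _; set M := (p %/ V)%N in J *.
set N := \sum_c h c ^+ 2.
have JP j k : j \in J -> (k <= M)%N -> 4 * shift_dist h (j *+ k) < N.
  by rewrite inE => /forallP hj kM; have := hj (Ordinal (kM : (k < M.+1)%N)).
rewrite leqNgt; apply/negP => big.
have [j0 j0J j00] : exists2 j, j \in J & j != 0.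
  have /subsetPn[j jJ j1] : ~~ (J \subset [set 0]).
    apply: contraL big => /subset_leq_card hJ; rewrite -leqNgt.
    by apply: leq_trans hJ _; rewrite cards1 addn1.
  by exists j => //; rewrite in_set1 in j1.
have [j jJ jS] : exists2 j, j \in J & j / j0 \notin small_ratios p V.
  have /subsetPn[j jJ j1] : ~~ (J \subset [set s * j0 | s in small_ratios p V]).
    apply: contraL big => /subset_leq_card hJ; rewrite -leqNgt.
    apply: leq_trans hJ (leq_trans (leq_imset_card _ _) _).
    exact: leq_trans (card_small_ratios p V) (leq_addr _ _).
  exists j => //; apply: contra j1 => hj; apply/imsetP.
  by exists (j / j0) => //; rewrite divfK.
(* z / j0 = s (+/-) i (j / j0), that is z = s j0 (+/-) i j. *)
have qz z : shift_dist h z <= N.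
  have [s [i [sM iM hz]]] := two_progressions pp hV jS (z / j0).
  have hs := JP _ _ j0J sM; have hi := JP _ _ jJ iM.
  have : shift_dist h z <= 2 * (shift_dist h (j0 *+ s) + shift_dist h (j *+ i)).
    have iE : i%:R * (j / j0) * j0 = j *+ i by rewrite -mulrA divfK // mulr_natl.
    have [->|->] : z = j0 *+ s + j *+ i \/ z = j0 *+ s - j *+ i.
      rewrite -[z](divfK j00); case: hz => ->; [left|right].
        by rewrite mulrDl iE mulr_natl.
      by rewrite mulrBl iE mulr_natl.
    - exact: shift_distD.
    - by rewrite -(shift_distN h (j *+ i)); apply: shift_distD.
  by move: hs hi; lra.
have N0 : 0 < N.
  by have := JP _ _ j0J (leq0n M); have := shift_dist_ge0 h (j0 *+ 0); lra.
have : \sum_(z : 'F_p) shift_dist h z <= \sum_(z : 'F_p) N by apply: ler_sum.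
rewrite sum_shift_dist // sumr_const -[N *+ _]mulr_natl -/N.
have : 0 < #|'F_p|%:R :> R by rewrite card_Fp // ltr0n prime_gt0.
set P := #|_|%:R; nra.
Qed.

Lemma ler_sum_window (R : realFieldType) (F : nat -> R) (k m n : nat) :
  (forall i, 0 <= F i) -> (k + m <= n)%N ->
  \sum_(i < m) F (k + i)%N <= \sum_(i < n) F i.
Proof.
move=> F0 /subnK <-; rewrite addnC !big_split_ord /=.
set A := \sum_(i < k) _; set B := \sum_(i < m) _; set C := \sum_(i < n - _) _.
have : 0 <= A by apply: sumr_ge0.
have : 0 <= C by apply: sumr_ge0.
lra.
Qed.

(** One multiple k0 j that moves h is enough for an average statement: for every k, one
    of the two multiples k j and (k0 + k) j moves h by a comparable amount. *)
Lemma shift_dist_progression (R : realFieldType) (p M : nat) (h : 'F_p -> R) (j : 'F_p) :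
  j \notin nearly_fixed h M ->
  M.+1%:R * \sum_c h c ^+ 2 <= 16 * \sum_(k < (2 * M).+1) shift_dist h (j *+ k).
Proof.
rewrite inE => /forallPn[/= k0]; rewrite -leNgt; set N := \sum_c _ => hk0.
have k0M := ltn_ord k0.
set Q := \sum_(k < _) _.
have h1 : \sum_(k < M.+1) shift_dist h (j *+ (k0 + k)) <= Q.
  apply: (@ler_sum_window _ (fun k => shift_dist h (j *+ k))) => [i|]; last by lia.
  exact: shift_dist_ge0.
have h2 : \sum_(k < M.+1) shift_dist h (j *+ (0 + k)) <= Q.
  apply: (@ler_sum_window _ (fun k => shift_dist h (j *+ k))) => [i|]; last by lia.
  exact: shift_dist_ge0.
have h3 : \sum_(k < M.+1) N <= \sum_(k < M.+1)
    (8 * (shift_dist h (j *+ (k0 + k)) + shift_dist h (j *+ (0 + k)))).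
  apply: ler_sum => k _; apply: le_trans hk0 _.
  have := shift_distD h (j *+ (k0 + k)) (- (j *+ k)).
  by rewrite shift_distN mulrnDr addrK add0n; lra.
move: h3; rewrite sumr_const card_ord -mulr_sumr big_split /= -[N *+ _]mulr_natl.
by move: h1 h2; lra.
Qed.

(** * Sums along parallel planes *)

Definition dot (p n : nat) (v : 'rV['F_p]_n) (u : 'cV['F_p]_n) : 'F_p := (v *m u) 0 0.

Lemma dotE (p n : nat) (v : 'rV['F_p]_n) (u : 'cV['F_p]_n) : dot v u = \sum_k v 0 k * u k 0.
Proof. by rewrite /dot mxE. Qed.

Lemma dotD (p n : nat) (v w : 'rV['F_p]_n) (u : 'cV['F_p]_n) :
  dot (v + w) u = dot v u + dot w u.
Proof. by rewrite /dot mulmxDl mxE. Qed.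

Lemma dotDr (p n : nat) (v : 'rV['F_p]_n) (u w : 'cV['F_p]_n) :
  dot v (u + w) = dot v u + dot v w.
Proof. by rewrite /dot mulmxDr mxE. Qed.

Lemma dotB (p n : nat) (v w : 'rV['F_p]_n) (u : 'cV['F_p]_n) :
  dot (v - w) u = dot v u - dot w u.
Proof. by rewrite /dot mulmxBl !mxE. Qed.

Lemma dotMn (p n : nat) (v : 'rV['F_p]_n) (u : 'cV['F_p]_n) (k : nat) :
  dot (v *+ k) u = dot v u *+ k.
Proof.
elim: k => [|k IH]; first by rewrite !mulr0n /dot mul0mx mxE.
by rewrite !mulrS dotD IH.
Qed.

Lemma dot_sum (p n : nat) (I : finType) (P : pred I) (x : I -> 'rV['F_p]_n)
    (u : 'cV['F_p]_n) :
  dot (\sum_(i | P i) x i) u = \sum_(i | P i) dot (x i) u.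
Proof.
rewrite /dot mulmx_suml summxE; exact: eq_bigr.
Qed.

(** The pairing with a nonzero z takes each of the p values equally often. *)
Lemma card_orthogonal (p n : nat) (z : 'rV['F_p]_n) :
  prime p -> z != 0 -> (p * #|[set u | (dot z u == 0)%R]| = p ^ n)%N.
Proof.
move=> pp z0.
have [k zk] : exists k, z 0 k != 0.
  apply/existsP; apply: contraT; rewrite negb_exists => /forallP h.
  case/eqP: z0; apply/rowP => k; rewrite mxE; apply/eqP.
  by have := h k; rewrite negbK.
pose w : 'cV['F_p]_n := (z 0 k)^-1 *: delta_mx k 0.
(* w pairs to 1 with z, so translation by c w maps the fibre over 0 to the fibre over c. *)
have zw c : dot z (c *: w) = c.
  rewrite dotE (bigD1 k) //= !mxE !eqxx mulr1 big1 ?addr0; first by rewrite mulrCA divff ?mulr1.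
  by move=> l lk; rewrite !mxE (negbTE lk) !mulr0.
have -> : (p ^ n)%N = #|{: 'cV['F_p]_n}| by rewrite card_mx card_Fp // muln1.
rewrite -[RHS]sum1_card [RHS](partition_big (dot z) xpredT) //=.
rewrite [RHS](eq_bigr (fun=> #|[set u | dot z u == 0]|)) ?sum_nat_const ?card_Fp // => c _.
rewrite sum1_card -[RHS](card_imset _ (addIr (c *: w))); apply: eq_card => u.
rewrite unfold_in; apply/eqP/imsetP => [/val_inj uc|[v]].
  exists (u - c *: w); last by rewrite subrK.
  by rewrite inE; apply/eqP; rewrite -[- (c *: w)]scaleNr dotDr zw uc subrr.
by rewrite inE => /eqP zv ->; rewrite dotDr zv zw add0r.
Qed.

(** The Radon transform of f: its sums along the affine planes with normal vector u. *)
Definition plane_sum (R : realFieldType) (p n : nat) (f : 'rV['F_p]_n -> R)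
    (u : 'cV['F_p]_n) (c : 'F_p) : R :=
  \sum_(y | dot y u == c) f y.

Lemma sum_plane_sum (R : realFieldType) (p n : nat) (f : 'rV['F_p]_n -> R)
    (u : 'cV['F_p]_n) :
  \sum_c plane_sum f u c = \sum_y f y.
Proof. by rewrite [RHS](partition_big (fun y => dot y u) xpredT). Qed.

(** Summing the squares of all plane sums counts each pair y, z with weight the number of
    u orthogonal to y - z, which is p^3 when y = z and p^2 otherwise.  The constant part
    p^2 disappears since f has mean zero. *)
Lemma radon_energy (R : realFieldType) (p : nat) (f : 'rV['F_p]_3 -> R) :
  prime p -> \sum_y f y = 0 ->
  \sum_u \sum_c plane_sum f u c ^+ 2 = (p ^ 3 - p ^ 2)%:R * \sum_y f y ^+ 2.
Proof.
move=> pp f0.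
have e1 u : \sum_c plane_sum f u c ^+ 2
    = \sum_y \sum_z (dot (y - z) u == 0)%:R * (f y * f z).
  rewrite [RHS](partition_big (fun y => dot y u) xpredT) //=; apply: eq_bigr => c _.
  rewrite expr2 big_distrl; apply: eq_bigr => y /eqP yc /=.
  rewrite big_distrr /= big_mkcond; apply: eq_bigr => z _.
  by rewrite dotB yc subr_eq0 eq_sym; case: eqP; rewrite ?mul1r ?mul0r.
have p2 : (p ^ 2 <= p ^ 3)%N by rewrite leq_pexp2l // prime_gt0.
have e2 (y z : 'rV['F_p]_3) : \sum_u (dot (y - z) u == 0)%:R
    = (p ^ 2)%:R + (y == z)%:R * (p ^ 3 - p ^ 2)%:R :> R.
  rewrite -natr_sum.
  have -> : (\sum_u (dot (y - z) u == 0)%R)%N = #|[set u | dot (y - z) u == 0]|.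
    by rewrite -sum1dep_card [RHS]big_mkcond; apply: eq_bigr => u _; case: eqP.
  case: eqVneq => [->|yz].
    rewrite mul1r -natrD addnC subnK // subrr; congr _%:R.
    transitivity #|{: 'cV['F_p]_3}|; last by rewrite card_mx card_Fp // muln1.
    by apply: eq_card => u; rewrite !inE /dot mul0mx mxE eqxx.
  rewrite mul0r addr0; congr _%:R; apply/eqP.
  by rewrite -(eqn_pmul2l (prime_gt0 pp)) card_orthogonal ?subr_eq0 // -expnS.
under eq_bigr => u _ do rewrite e1.
rewrite exchange_big /=; under eq_bigr => y _ do rewrite exchange_big /=.
transitivity (\sum_y (p ^ 3 - p ^ 2)%:R * f y ^+ 2); last by rewrite mulr_sumr.
apply: eq_bigr => y _.
under eq_bigr => z _ do rewrite -mulr_suml e2 mulrDl mulrA.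
rewrite big_split /= -!mulr_sumr f0 mulr0 add0r (bigD1 y) //= eqxx mul1r.
rewrite big1 ?addr0 // => z zy; first by rewrite eq_sym (negbTE zy) !mul0r.
Qed.

Lemma plane_sum_shift (R : realFieldType) (p n : nat) (f : 'rV['F_p]_n -> R) (u : 'cV['F_p]_n)
    (g : 'rV['F_p]_n) (c : 'F_p) :
  plane_sum (fun y => f y - f (y + g)) u c = plane_sum f u c - plane_sum f u (c + dot g u).
Proof.
rewrite /plane_sum big_split /= sumrN; congr (_ - _).
rewrite [RHS](reindex_inj (addIr g)); apply: eq_bigl => y.
by rewrite dotD (inj_eq (addIr _)).
Qed.

(** Translating f by g translates its plane sums with normal vector u by the pairing of
    g and u, so a displacement in dimension 3 is distributed over the displacements in
    dimension 1. *)
Lemma radon_shift (R : realFieldType) (p : nat) (f : 'rV['F_p]_3 -> R) (g : 'rV['F_p]_3) :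
  prime p ->
  \sum_u shift_dist (plane_sum f u) (dot g u) = (p ^ 3 - p ^ 2)%:R * shift_dist f g.
Proof.
move=> pp; rewrite -radon_energy //.
  apply: eq_bigr => u _; apply: eq_bigr => c _; by rewrite plane_sum_shift.
rewrite big_split /= sumrN [X in _ - X](_ : _ = \sum_y f y) ?subrr //.
by rewrite [RHS](reindex_inj (addIr g)).
Qed.

(** * Expansion by a spread sequence *)

(** No affine plane contains more than 4p terms.  The planes avoiding the origin matter:
    a sequence inside a plane that does not contain 0 is two-dimensional as well. *)
Definition spread (p : nat) (I : finType) (x : I -> 'rV['F_p]_3) (S : {set I}) : Prop :=
  forall u c, u != 0 -> (#|[set i in S | (dot (x i) u == c)%R]| <= 4 * p)%N.

Lemma spreadS (p : nat) (I : finType) (x : I -> 'rV['F_p]_3) (R S : {set I}) :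
  R \subset S -> spread x S -> spread x R.
Proof.
move=> /subsetP RS h u c u0; apply: leq_trans (h u c u0); apply: subset_leq_card.
by apply/subsetP => i; rewrite !inE => /andP[/RS -> ->].
Qed.

(** The bound of [card_nearly_fixed]. *)
Definition bad_bound (V : nat) : nat := (2 * (V * V) * V.+1 + 1)%N.

Lemma card_shift_preim (p : nat) (I : finType) (x : I -> 'rV['F_p]_3) (R : {set I})
    (u : 'cV['F_p]_3) (J : {set 'F_p}) :
  spread x R -> u != 0 -> (#|[set i in R | dot (x i) u \in J]| <= #|J| * (4 * p))%N.
Proof.
move=> sR u0; rewrite -sum1_card (partition_big (fun i => dot (x i) u) (mem J)) /=.
  rewrite -sum_nat_const; apply: leq_sum => c cJ; apply: leq_trans (sR u c u0).
  rewrite sum1_card; apply: subset_leq_card; apply/subsetP => i.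
  by rewrite unfold_in !inE -andbA => /and3P[-> _ ->].
by move=> i; rewrite inE => /andP[].
Qed.

(** By [card_nearly_fixed] and spreadness, for every nonzero u at most half of the terms
    pair with u into a residue almost fixing the plane sums; each of the other terms
    contributes as in [shift_dist_progression].  For u = 0 the plane sums vanish. *)
Lemma plane_energy_lower (p V : nat) (I : finType) (x : I -> 'rV['F_p]_3) (R : {set I})
    (f : 'rV['F_p]_3 -> rat) (u : 'cV['F_p]_3) :
  prime p -> (0 < V < p)%N -> spread x R -> (8 * bad_bound V * p <= #|R|)%N ->
  \sum_y f y = 0 ->
  #|R|%:R * (p %/ V).+1%:R * \sum_c plane_sum f u c ^+ 2 <=
  32 * \sum_(i in R) \sum_(k < (2 * (p %/ V)).+1) shift_dist (plane_sum f u) (dot (x i) u *+ k).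
Proof.
move=> pp hV sR hR f0; set M := (p %/ V)%N; set h := plane_sum f u.
pose q i := \sum_(k < (2 * M).+1) shift_dist h (dot (x i) u *+ k).
rewrite -[X in _ <= 32 * X]/(\sum_(i in R) q i).
have q0 i : 0 <= q i by apply: sumr_ge0 => k _; exact: shift_dist_ge0.
have [u0|u0] := eqVneq u 0.
  have h0 c : h c = 0.
    rewrite /h /plane_sum u0; case: (eqVneq c 0) => [->|c0].
      by rewrite -[RHS]f0; apply: eq_bigl => y; rewrite /dot mulmx0 mxE eqxx.
    by rewrite big_pred0 // => y; rewrite /dot mulmx0 mxE eq_sym (negbTE c0).
  rewrite big1 ?mulr0; last by move=> c _; rewrite h0 expr0n.
  by rewrite mulr_ge0 // sumr_ge0.
have hh : \sum_c h c = 0 by rewrite sum_plane_sum.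
set N := \sum_c h c ^+ 2; have N0 : 0 <= N by apply: sumr_ge0 => c _; exact: sqr_ge0.
(* The terms with a multiple that moves h; they are at least half of R. *)
set G := [set i in R | dot (x i) u \notin nearly_fixed h M].
have cG : (#|R| <= 2 * #|G|)%N.
  have hJ := card_nearly_fixed pp hV hh.
  have := card_shift_preim (nearly_fixed h M) sR u0; set B := [set i in R | _] => hB.
  have RE : (#|B| + #|G| = #|R|)%N.
    rewrite -(cardsID B R) /B; congr (_ + _)%N; apply: eq_card => i; rewrite !inE.
      by rewrite andbA andbb.
    by case: (i \in R); rewrite ?andbF ?andbT.
  have aux b g r j k t : (j <= k -> b <= j * (4 * t) -> b + g = r -> 8 * k * t <= r ->
     r <= 2 * g)%N by nia.
  exact: aux hJ hB RE hR.
have hG : #|G|%:R * (M.+1%:R * N) <= 16 * \sum_(i in R) q i.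
  rewrite (bigID (fun i => i \in G)) /= mulrDr -[X in X <= _]addr0.
  apply: lerD; last by rewrite mulr_ge0 // sumr_ge0.
  rewrite (mulr_natl _ #|G|) -sumr_const.
  rewrite [X in _ <= X](_ : _ = \sum_(i in G) 16 * q i); last first.
    by rewrite mulr_sumr; apply: eq_bigl => i; rewrite !inE andbA andbb.
  apply: ler_sum => i; rewrite inE => /andP[_]; exact: shift_dist_progression.
have cG' : #|R|%:R <= 2 * #|G|%:R :> rat by rewrite -natrM ler_nat.
have M0 : 0 <= M.+1%:R * N by rewrite mulr_ge0.
rewrite -mulrA; move: cG' M0 hG; set a := #|R|%:R; set b := #|G|%:R.
set m := M.+1%:R * N; set Q := \sum_(i in R) _; nra.
Qed.

Definition centred (V : finZmodType) (Y : {set V}) (y : V) : rat :=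
  (y \in Y)%:R - #|Y|%:R / #|V|%:R.

Lemma sum_indicator (V : finZmodType) (Y : {set V}) : \sum_y (y \in Y)%:R = #|Y|%:R :> rat.
Proof.
rewrite -sum1_card natr_sum [RHS]big_mkcond; apply: eq_bigr => y _.
by case: (y \in Y).
Qed.

Lemma sum_centred (V : finZmodType) (Y : {set V}) : \sum_y centred Y y = 0.
Proof.
rewrite sumrB sum_indicator sumr_const -[X in _ - X]mulr_natr divfK ?subrr //.
by rewrite pnatr_eq0 -lt0n; apply/card_gt0P; exists 0.
Qed.

Lemma sum_centred_sq (V : finZmodType) (Y : {set V}) :
  (2 * #|Y| <= #|V|)%N -> #|Y|%:R <= 2 * \sum_y centred Y y ^+ 2.
Proof.
move=> YV; pose b : rat := #|Y|%:R / #|V|%:R.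
have e y : centred Y y ^+ 2 = (y \in Y)%:R - b * (y \in Y)%:R - b * centred Y y.
  by rewrite /centred -/b; case: (y \in Y) => /=; ring.
have -> : \sum_y centred Y y ^+ 2 = #|Y|%:R - b * #|Y|%:R.
  under eq_bigr => y _ do rewrite e.
  by rewrite !sumrB -!mulr_sumr sum_centred mulr0 subr0 sum_indicator.
have V0 : 0 < #|V|%:R :> rat by rewrite ltr0n; apply/card_gt0P; exists 0.
have : b <= 1 / 2.
  by rewrite /b ler_pdivrMr //; move: YV; rewrite -(ler_nat rat) natrM; lra.
have : 0 <= #|Y|%:R :> rat by [].
set c := #|Y|%:R; nra.
Qed.

(** The difference of the two indicators is supported on the points that enter or leave
    Y, and these are equally many. *)
Lemma shift_dist_centred (V : finZmodType) (Y : {set V}) (g : V) :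
  shift_dist (centred Y) g = 2 * (bdry Y g)%:R.
Proof.
have e (y : V) : (centred Y y - centred Y (y + g)) ^+ 2
    = (y \in [set z in Y | z + g \notin Y])%:R + (y + g \in [set z in Y | z - g \notin Y])%:R.
  rewrite /centred !inE addrK.
  by case: (y \in Y); case: (y + g \in Y) => /=; ring.
rewrite /shift_dist; under eq_bigr => y _ do rewrite e.
rewrite big_split /= sum_indicator.
have -> (W : {set V}) : \sum_y (y + g \in W)%:R = #|W|%:R :> rat.
  by rewrite -sum_indicator [RHS](reindex_inj (addIr g)).
by rewrite -/(bdry Y g) -/(bdry Y (- g)) bdryN -mulr2n mulr_natl.
Qed.

(** The final computation of [expansion]: e is the squared norm of the centred indicator,
    y the size of Y, s and t the sums of boundaries over multiples of terms and over
    terms, r the number of terms and c the common Radon factor. *)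
Lemma expansion_arith (R : realFieldType) (r m c e y s t M : R) :
  0 < r -> 0 < m -> 0 < c -> r * m * (c * e) <= 32 * (c * s) -> s <= 8 * m * M * t ->
  512 * M * t <= r * (y - 1) -> y <= 2 * e -> False.
Proof.
move=> r0 m0 c0 h1 h2 h3 h4.
have {}h1 : r * m * e <= 32 * s by rewrite -(ler_pM2l c0) mulrCA [c * (32 * _)]mulrCA.
have {}h1 : r * e <= 256 * (M * t).
  rewrite -(ler_pM2l m0); apply: le_trans (_ : 32 * s <= _); first by lra.
  by move: h2; rewrite -!mulrA => h2; lra.
have {}h4 : r * y <= r * (2 * e) by rewrite ler_pM2l.
by lra.
Qed.

(** Summing [plane_energy_lower] over all u bounds from below the total boundary of the
    multiples k (x i) with k <= 2 p/V, and the boundary of k g is at most k times that of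
    g.  The constant does not depend on V, which is therefore free to be large. *)
Lemma expansion (p V : nat) (I : finType) (x : I -> 'rV['F_p]_3) (R : {set I})
    (Y : {set 'rV['F_p]_3}) :
  prime p -> (0 < V < p)%N -> spread x R -> (8 * bad_bound V * p <= #|R|)%N ->
  (0 < #|Y|)%N -> (2 * #|Y| <= p ^ 3)%N ->
  exists2 i, i \in R & (#|Y| <= 512 * (p %/ V) * bdry Y (x i))%N.
Proof.
move=> pp hV sR hR Y0 Yp; set M := (p %/ V)%N.
have p1 := prime_gt1 pp.
have cV : #|{: 'rV['F_p]_3}| = (p ^ 3)%N by rewrite card_mx card_Fp // mul1n.
apply/exists_inP; apply: contraT => /exists_inPn /= hno.
pose f := centred Y.
have f0 : \sum_y f y = 0 := sum_centred Y.
have M0 : (0 < M)%N by rewrite /M divn_gt0; case/andP: hV => // V0 /ltnW.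
have R0 : 0 < #|R|%:R :> rat.
  by rewrite ltr0n; apply: leq_trans hR; rewrite /bad_bound addn1 !muln_gt0 /= prime_gt0.
pose E := \sum_y f y ^+ 2.
have hE : #|Y|%:R <= 2 * E by apply: sum_centred_sq; rewrite cV.
pose c : rat := (p ^ 3 - p ^ 2)%:R.
have c0 : 0 < c by rewrite ltr0n subn_gt0 ltn_exp2l.
have h1 : #|R|%:R * M.+1%:R * (c * E) <=
    32 * (c * \sum_(i in R) \sum_(k < (2 * M).+1) (2 * (bdry Y (x i *+ k))%:R)).
  have -> : c * E = \sum_u \sum_d plane_sum f u d ^+ 2 by rewrite (radon_energy pp f0).
  have -> : c * (\sum_(i in R) \sum_(k < (2 * M).+1) (2 * (bdry Y (x i *+ k))%:R))
      = \sum_u \sum_(i in R) \sum_(k < (2 * M).+1)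
          shift_dist (plane_sum f u) (dot (x i) u *+ k).
    rewrite [RHS]exchange_big mulr_sumr; apply: eq_bigr => i _ /=.
    rewrite [RHS]exchange_big mulr_sumr; apply: eq_bigr => k _ /=.
    rewrite -shift_dist_centred -(radon_shift _ _ pp); apply: eq_bigr => u _.
    by rewrite dotMn.
  rewrite !mulr_sumr; apply: ler_sum => u _; exact: (plane_energy_lower u pp hV sR hR f0).
have h2 : \sum_(i in R) \sum_(k < (2 * M).+1) (2 * (bdry Y (x i *+ k))%:R) <=
    8 * M.+1%:R * M%:R * \sum_(i in R) (bdry Y (x i))%:R :> rat.
  rewrite mulr_sumr; apply: ler_sum => i _.
  apply: (@le_trans _ _ (\sum_(k < (2 * M).+1) (4 * M%:R * (bdry Y (x i))%:R))).
    apply: ler_sum => k _; have := bdryMn Y (x i) k; have kM := ltn_ord k.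
    rewrite -!natrM ler_nat; set b1 := bdry _ _; set b2 := bdry _ _ => hb; nia.
  rewrite sumr_const card_ord -[X in X <= _]mulr_natl -!natrM ler_nat; nia.
have h3 : 512 * M%:R * \sum_(i in R) (bdry Y (x i))%:R <= #|R|%:R * (#|Y|%:R - 1) :> rat.
  rewrite mulr_sumr (mulr_natl _ #|R|) -sumr_const; apply: ler_sum => i iR.
  have := hno i iR; rewrite -ltnNge => hi.
  rewrite lerBrDr -!natrM natr1 ler_nat; exact: hi.
by case: (expansion_arith R0 (ltr0Sn _ M) c0 h1 h2 h3 hE).
Qed.

(** * Greedy growth of the set of subset sums *)

(** Otherwise a nonzero vector u is orthogonal to all terms, which then lie on one plane. *)
Lemma row_free_terms (p : nat) (I : finType) (x : I -> 'rV['F_p]_3) (R : {set I}) :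
  prime p -> spread x R -> (4 * p < #|R|)%N ->
  exists e : 'I_3 -> I, (forall j, e j \in R) /\ row_free (\matrix_j x (e j)).
Proof.
move=> pp sR hR; pose X : 'M['F_p]_(#|R|, 3) := \matrix_i x (enum_val i).
have rX : row_full X.
  apply: contraT => nfull.
  have K0 : cokermx X != 0.
    rewrite -mxrank_eq0 mxrank_coker subn_eq0 -ltnNge ltn_neqAle rank_leq_col andbT.
    exact: nfull.
  have [k Kk] : exists k, col k (cokermx X) != 0.
    apply/existsP; apply: contraT; rewrite negb_exists => /forallP h.
    case/eqP: K0; apply/matrixP => i k; rewrite mxE.
    by have := h k; rewrite negbK => /eqP/colP/(_ i); rewrite !mxE.
  have := sR _ 0 Kk; rewrite leqNgt => /negP[]; apply: leq_trans hR _.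
  apply: subset_leq_card; apply/subsetP => i iR; rewrite inE iR /=.
  have := mulmx_coker X => /matrixP/(_ (enum_rank_in iR i) k).
  rewrite mxE [RHS]mxE => h; rewrite dotE -[X in _ == X]h; apply/eqP; apply: eq_bigr => l _.
  by rewrite !mxE enum_rankK_in.
exists (fun j => enum_val (fullrankfun rX j)); split; first by move=> j; apply: enum_valP.
have -> : \matrix_j x (enum_val (fullrankfun rX j)) = rowsub (fullrankfun rX) X.
  by apply/matrixP => i j; rewrite !mxE.
by rewrite row_free_unit fullrowsub_unit.
Qed.

Lemma box_injective (p L : nat) (I : finType) (x : I -> 'rV['F_p]_3) (e : 'I_3 -> I) :
  prime p -> (L <= p)%N -> row_free (\matrix_j x (e j)) ->
  injective (fun c : {ffun 'I_3 -> 'I_L} => \sum_j x (e j) *+ c j).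
Proof.
move=> pp Lp fB c d; set B := \matrix_j _ in fB.
have E (b : {ffun 'I_3 -> 'I_L}) :
    \sum_j x (e j) *+ b j = (\row_j (b j : nat)%:R) *m B.
  rewrite mulmx_sum_row; apply: eq_bigr => j _.
  by rewrite rowK mxE scaler_nat.
rewrite !E => /(row_free_inj fB)/rowP h; apply/ffunP => j; apply: val_inj => /=.
have := h j; rewrite !mxE => hj.
have lt b : (b < L)%N -> nat_of_ord (b%:R : 'F_p) = b.
  by move=> bL; rewrite val_Fp_nat // modn_small // (leq_trans bL).
by rewrite -[LHS]lt ?hj ?lt.
Qed.

(** The L^3 sums of a box over three independent terms are distinct, so one of them has a
    boundary of at least half of Y, and by subadditivity one of the three terms has a
    boundary of at least |Y| / 6L. *)
Lemma base_expansion (p L : nat) (I : finType) (x : I -> 'rV['F_p]_3) (R : {set I})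
    (Y : {set 'rV['F_p]_3}) :
  prime p -> spread x R -> (4 * p < #|R|)%N -> (L <= p)%N ->
  (0 < #|Y|)%N -> (2 * #|Y| <= L ^ 3)%N ->
  exists2 i, i \in R & (#|Y| <= 6 * L * bdry Y (x i))%N.
Proof.
move=> pp sR hR Lp Y0 YL; have [e [eR fB]] := row_free_terms pp sR hR.
have inj := box_injective pp Lp fB.
have [|g /imsetP[c _ ->] hg] :=
  @bdry_average _ Y [set \sum_j x (e j) *+ c j | c : {ffun 'I_3 -> 'I_L}] Y0.
  by rewrite card_imset // card_ffun !card_ord.
apply/exists_inP; apply: contraT => /exists_inPn /= hno.
have h1 : (bdry Y (\sum_j x (e j) *+ c j)%R <= \sum_j L * bdry Y (x (e j)))%N.
  apply: leq_trans (bdry_sum _ _) _; apply: leq_sum => j _.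
  by apply: leq_trans (bdryMn _ _ _) _; rewrite leq_mul2r ltnW ?orbT.
have h2 : (6 * (\sum_j L * bdry Y (x (e j))) <= \sum_(j < 3) #|Y|.-1)%N.
  rewrite big_distrr; apply: leq_sum => j _ /=.
  have := hno _ (eR j); rewrite -ltnNge mulnA; set a := #|Y|; lia.
move: h2; rewrite sum_nat_const card_ord.
have aux y b s : (y <= 2 * b -> b <= s -> 6 * s <= 3 * y.-1 -> 0 < y -> False)%N by lia.
by move=> h2; case: (aux _ _ _ hg h1 h2 Y0).
Qed.

(** From n^3 to (n + 1)^3 by a bounded number of terms.  A box of side 3n applies since
    2 (n + 1)^3 <= 27 n^3, and yields boundaries of at least n^2 / 18; hence 126 = 18 * 7
    terms gain 7 n^2 elements, enough since (n + 1)^3 - n^3 <= 7 n^2. *)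
Lemma cubic_growth (p : nat) (I : finType) (x : I -> 'rV['F_p]_3) (S : {set I}) (n : nat) :
  prime p -> spread x S -> (0 < n)%N -> (3 * n <= p)%N -> (4 * p + 126 * n < #|S|)%N ->
  exists T : {set I}, [/\ T \subset S, (#|T| <= 126 * n)%N & (n ^ 3 <= #|subsums x T|)%N].
Proof.
move=> pp sS; elim: n => [//|n IH] _ np nS.
case: (posnP n) => [->|n0].
  exists set0; split; rewrite ?sub0set ?cards0 // exp1n card_gt0; apply/set0Pn.
  by exists 0; apply/subsumsP; exists set0; rewrite ?sub0set ?big_set0.
have [||T [TS cT hT]] := IH n0; [lia|lia|].
have [|T' [T'S cT' h]] := @greedy_growth _ _ x S T 18 (n ^ 2) (n.+1 ^ 3) 126 isT TS.
  move=> T' T'S cT' leT ltT.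
  have c0 : (#|S :\: T'| + #|T'| = #|S|)%N.
    by rewrite cardsD (setIidPr T'S) subnK // subset_leq_card.
  have [|||||i iR hi] := @base_expansion p (3 * n) _ x (S :\: T') (subsums x T') pp.
  - exact: spreadS (subsetDl _ _) sS.
  - by lia.
  - by lia.
  - by apply: leq_trans leT; apply: leq_trans hT; rewrite expn_gt0 n0.
  - move: ltT; rewrite !expnS !expn0 !muln1; set y := #|_|; nia.
  exists i => //; have := leq_trans hT leT.
  move: hi; set y := #|_|; set b := bdry _ _; rewrite !expnS !expn0 !muln1.
  move=> h1 h2; have : (n * (n * n) <= n * (18 * b))%N by lia.
  by rewrite leq_pmul2l.
exists T'; split=> //; first by lia.
case: h => // h; move: h hT; set y := #|_|; set z := #|_|; rewrite !expnS !expn0 !muln1; nia.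
Qed.

(** With D = 512 (p/V), each term gains at least |Y| / D elements, so D terms double Y. *)
Lemma doubling_growth (p V : nat) (I : finType) (x : I -> 'rV['F_p]_3) (S T : {set I}) (m : nat) :
  prime p -> (0 < V < p)%N -> spread x S -> T \subset S ->
  (0 < #|subsums x T|)%N ->
  (8 * bad_bound V * p + #|T| + m * (512 * (p %/ V)) <= #|S|)%N ->
  exists T' : {set I}, [/\ T' \subset S, (#|T'| <= #|T| + m * (512 * (p %/ V)))%N &
    (p ^ 3 < 2 * #|subsums x T'|)%N \/ (2 ^ m * #|subsums x T| <= #|subsums x T'|)%N].
Proof.
move=> pp hV sS TS y0; elim: m => [|m IH] hS.
  by exists T; split=> //; [rewrite addn0|right; rewrite mul1n].
have D0 : (0 < 512 * (p %/ V))%N.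
  by rewrite muln_gt0 /= divn_gt0; case/andP: hV => // V0 /ltnW.
set D := (512 * (p %/ V))%N in D0 hS IH *.
have [|T1 [T1S cT1 h1]] := IH; first by lia.
case: (ltnP (p ^ 3) (2 * #|subsums x T1|)) => hp.
  by exists T1; split=> //; [lia|left].
have {}h1 : (2 ^ m * #|subsums x T| <= #|subsums x T1|)%N.
  by case: h1 => //; rewrite ltnNge hp.
have y1 : (0 < #|subsums x T1|)%N by apply: leq_trans h1; rewrite muln_gt0 expn_gt0 y0.
have [|T' [T'S cT' h]] := @greedy_growth _ _ x S T1 D #|subsums x T1| (p ^ 3 %/ 2).+1 D D0 T1S.
  move=> T' T'S cT' leT ltT.
  have c0 : (#|S :\: T'| + #|T'| = #|S|)%N.
    by rewrite cardsD (setIidPr T'S) subnK // subset_leq_card.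
  have [||||i iR hi] := @expansion p V _ x (S :\: T') (subsums x T') pp hV.
  + exact: spreadS (subsetDl _ _) sS.
  + by lia.
  + exact: leq_trans leT.
  + by move: ltT; rewrite ltnS leq_divRL // mulnC.
  by exists i => //; apply: leq_trans leT hi.
exists T'; split=> //; first by lia.
case: h => [h|h].
  by left; move: h; rewrite ltn_divLR // mulnC.
right; rewrite expnS -mulnA; apply: leq_trans (_ : 2 * #|subsums x T1| <= _)%N.
  by rewrite leq_mul2l h1.
by move: h; rewrite -mulnDr leq_pmul2l // mul2n -addnn.
Qed.

(** * Short zero-sum subsequences in F_p^3 *)

(** Cubic growth up to n^3, followed by m doublings. *)
Lemma half_cover (p V n m : nat) (I : finType) (x : I -> 'rV['F_p]_3) (S : {set I}) :
  prime p -> (0 < V < p)%N -> spread x S -> (0 < n)%N -> (3 * n <= p)%N ->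
  (p ^ 3 <= 2 ^ m * n ^ 3)%N ->
  (8 * bad_bound V * p + (126 * n + m * (512 * (p %/ V))) <= #|S|)%N ->
  exists T : {set I}, [/\ T \subset S,
    (#|T| <= 126 * n + m * (512 * (p %/ V)))%N & (p ^ 3 < 2 * #|subsums x T|)%N].
Proof.
move=> pp hV sS n0 np hm hS; have p0 := prime_gt0 pp.
have hp : (8 * p <= 8 * bad_bound V * p)%N.
  by rewrite leq_mul2r -[X in (X <= _)%N]muln1 leq_mul2l /bad_bound addn1 orbT.
set D := (512 * (p %/ V))%N in hS *.
have [|T [TS cT hT]] := cubic_growth pp sS n0 np; first by lia.
have y0 : (0 < #|subsums x T|)%N by apply: leq_trans hT; rewrite expn_gt0 n0.
have [|T' [T'S cT' h]] := doubling_growth (m := m) pp hV sS TS y0; first by rewrite -/D; lia.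
exists T'; split=> //; first by move: cT'; rewrite -/D; lia.
case: h => // h.
have h2 : (2 ^ m * n ^ 3 <= 2 ^ m * #|subsums x T|)%N by rewrite leq_mul2l hT orbT.
have h3 := leq_trans hm (leq_trans h2 h).
apply: (leq_ltn_trans h3); rewrite -[X in (X < _)%N]mul1n ltn_pmul2r //.
by apply: leq_trans h3; rewrite expn_gt0 p0.
Qed.

(** Two disjoint sets of terms have more than half of the group as subset sums; hence
    the opposite of a further term a is a sum of one subset sum of each.  Including a makes
    the resulting zero-sum subset nonempty. *)
Lemma zero_sum_of_spread (p V n m : nat) (I : finType) (x : I -> 'rV['F_p]_3) (S : {set I}) :
  prime p -> (0 < V < p)%N -> spread x S -> (0 < n)%N -> (3 * n <= p)%N ->
  (p ^ 3 <= 2 ^ m * n ^ 3)%N ->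
  (2 * (126 * n + m * (512 * (p %/ V))) < p)%N ->
  (8 * bad_bound V * p + p <= #|S|)%N ->
  exists T : {set I},
    [/\ T \subset S, T != set0, (#|T| <= p)%N & \sum_(i in T) x i = 0].
Proof.
move=> pp hV sS n0 np hm; set E := (126 * n + _)%N => hE hS.
have [|T1 [T1S cT1 h1]] := half_cover pp hV sS n0 np hm; first by rewrite -/E; lia.
have c1 : (#|S :\: T1| + #|T1| = #|S|)%N.
  by rewrite cardsD (setIidPr T1S) subnK // subset_leq_card.
have s1 := spreadS (subsetDl S T1) sS.
rewrite -/E in cT1.
have [|T2 [T2S cT2 h2]] := half_cover pp hV s1 n0 np hm; first by rewrite -/E; lia.
rewrite -/E in cT2.
have c2 : (#|(S :\: T1) :\: T2| + #|T2| = #|S :\: T1|)%N.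
  by rewrite cardsD (setIidPr T2S) subnK // subset_leq_card.
have [a] : exists a, a \in (S :\: T1) :\: T2 by apply/set0Pn; rewrite -card_gt0; lia.
rewrite !inE => /and3P[aT2 aT1 aS].
have [|y [z [/subsumsP[U1 U1T ->] /subsumsP[U2 U2T ->] yz]]] :=
  @sumset_cover _ (subsums x T1) (subsums x T2) (- x a).
  by rewrite card_mx card_Fp // mul1n; lia.
have dU : [disjoint U1 & U2].
  apply: disjointWl U1T _; apply: disjointWr U2T _.
  by rewrite disjoint_sym disjoints_subset; apply: subset_trans T2S _; rewrite setDE subsetIr.
have aU : a \notin U1 :|: U2.
  by rewrite inE negb_or (contra (subsetP U1T a)) // (contra (subsetP U2T a)).
exists (a |: (U1 :|: U2)); split.
- rewrite subUset sub1set aS subUset (subset_trans U1T) //=.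
  by apply: subset_trans U2T (subset_trans T2S (subsetDl _ _)).
- by apply/set0Pn; exists a; rewrite setU11.
- have cU1 := leq_trans (subset_leq_card U1T) cT1.
  have cU2 := leq_trans (subset_leq_card U2T) cT2.
  rewrite cardsU1 aU; apply: leq_trans hE; rewrite add1n ltnS mul2n -addnn.
  exact: leq_trans (leq_card_setU U1 U2) (leq_add cU1 cU2).
- rewrite big_setU1 //= (eq_bigl [in [predU U1 & U2]]) => [|i]; last by rewrite !inE.
  by rewrite bigU //= yz subrr.
Qed.

(** If u has a nonzero coordinate k, a plane normal to u is determined by its other two
    coordinates.  Exactly p terms are needed: then the sum pairs with u to p c = 0, so
    that its coordinate k vanishes as well. *)
Lemma zero_sum_in_plane (p : nat) (I : finType) (x : I -> 'rV['F_p]_3) (P : {set I})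
    (u : 'cV['F_p]_3) (c : 'F_p) :
  prime p -> (2 < p)%N -> u != 0 -> (forall i, i \in P -> dot (x i) u = c) ->
  (4 * p <= #|P|)%N ->
  exists T : {set I}, [/\ T \subset P, #|T| = p & \sum_(i in T) x i = 0].
Proof.
move=> pp p2 u0 hP cP.
have [k uk] : exists k, u k 0 != 0.
  apply/existsP; apply: contraT; rewrite negb_exists => /forallP h.
  case/eqP: u0; apply/colP => k; rewrite mxE; apply/eqP.
  by have := h k; rewrite negbK.
have [|T [TP cT h0 h1]] := egz_plane (fun i => x i 0 (lift k ord0))
  (fun i => x i 0 (lift k ord_max)) (S := P) pp p2; first by lia.
exists T; split=> //; set s := \sum_(i in T) x i.
have sl (j : 'I_2) : s 0 (lift k j) = 0.
  (* The two coordinates other than k are lift k 0 and lift k 1. *)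
  rewrite summxE; case: (unliftP ord0 j) => [l ->|->]; last exact: h0.
  by rewrite (ord1 l) -[RHS]h1; apply: eq_bigr => i _; congr (x i 0 (lift k _)); apply: val_inj.
have du : dot s u = 0.
  rewrite dot_sum (eq_bigr (fun=> c)) => [|i iT]; last by rewrite hP // (subsetP TP).
  by rewrite sumr_const cT -mulr_natl pchar_Fp_0 // mul0r.
have sk : s 0 k = 0.
  move: du; rewrite dotE (bigD1 k) //= big1 ?addr0 => [/eqP|j jk].
    by rewrite mulf_eq0 (negbTE uk) orbF => /eqP.
  by case: (unliftP k j) jk => [l ->|->]; rewrite ?eqxx // sl mul0r.
apply/rowP => j; rewrite mxE; case: (unliftP k j) => [l ->|->] //.
Qed.

Lemma zero_sum_repeated (V : finZmodType) (p : nat) (I : finType) (x : I -> V) (S : {set I}) :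
  (0 < p)%N -> (forall v : V, v *+ p = 0) -> (#|V| * p <= #|S|)%N ->
  exists T : {set I},
    [/\ T \subset S, T != set0, (#|T| <= p)%N & \sum_(i in T) x i = 0].
Proof.
move=> p0 hp hS.
have [v hv] : exists v, (p <= #|[set i in S | x i == v]|)%N.
  apply/existsP; apply: contraT; rewrite negb_exists => /forallP h.
  have : (#|S| <= \sum_(v : V) p.-1)%N.
    rewrite -sum1_card (partition_big x xpredT) //=; apply: leq_sum => v _.
    have := h v; rewrite -ltnNge -[p in (_ < p)%N]prednK // ltnS; apply: leq_trans.
    by rewrite sum1_card; apply: subset_leq_card; apply/subsetP => i; rewrite unfold_in inE.
  rewrite sum_nat_const => /(leq_trans hS); rewrite leq_pmul2l; last first.
    by apply/card_gt0P; exists 0.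
  by rewrite leqNgt prednK // leqnn.
have [T TS cT] := subset_of_card hv; exists T; split.
- by apply: subset_trans TS _; apply/subsetP => i; rewrite inE => /andP[].
- by rewrite -card_gt0 cT.
- by rewrite cT.
- rewrite (eq_bigr (fun=> v)) => [|i /(subsetP TS)]; last by rewrite inE => /andP[_ /eqP].
  by rewrite sumr_const cT hp.
Qed.

(** The Alon-Dubiner theorem in dimension 3.  For p <= V some vector is repeated p times.
    For p > V and a spread sequence, n of order p/1008 brings the subset sums to at least
    p^3 / 2^33, and 33 doublings remain.  Each phase uses at most p/8 terms. *)
Lemma short_zero_sum_Fp3 : exists C : nat, forall (p : nat), prime p ->
  forall (I : finType) (x : I -> 'rV['F_p]_3) (S : {set I}), (C * p <= #|S|)%N ->
  exists T : {set I},
    [/\ T \subset S, T != set0, (#|T| <= p)%N & \sum_(i in T) x i = 0].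
Proof.
(* V keeps 33 doublings of 512 (p/V) terms each below p/8; it is hidden behind an existential
     so that it is never computed. *)
have [V hV] : exists V, V = (8 * (33 * 512))%N by eexists.
have V8 : (126 * 8 <= V)%N by lia.
exists (V ^ 3 + (8 * bad_bound V + 1))%N => p pp I x S hS.
have p0 := prime_gt0 pp.
case: (leqP p V) => pV.
  apply: zero_sum_repeated => // [v|].
    by rewrite -scaler_nat pchar_Fp_0 // scale0r.
  rewrite card_mx card_Fp // mul1n; apply: leq_trans hS.
  by rewrite leq_mul2r (leq_trans _ (leq_addr _ _)) ?orbT // leq_exp2r.
have {}hS : (8 * bad_bound V * p + p <= #|S|)%N.
  apply: leq_trans hS; rewrite mulnDl mulnDl mul1n; exact: leq_addl.
have [/existsP[u /existsP[c /andP[u0 hc]]]|hno] :=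
  boolP [exists u : 'cV['F_p]_3, exists c : 'F_p, (u != 0) &&
    (4 * p < #|[set i in S | dot (x i) u == c]|)%N].
  have [||||T [TP cT hT]] := @zero_sum_in_plane p I x [set i in S | dot (x i) u == c] u c pp.
  - by lia.
  - by [].
  - by move=> i; rewrite inE => /andP[_ /eqP].
  - exact: ltnW.
  exists T; split=> //; last by rewrite cT.
    by apply: subset_trans TP _; apply/subsetP => i; rewrite inE => /andP[].
  by rewrite -card_gt0 cT.
have sS : spread x S.
  move=> u c u0; rewrite leqNgt; apply: contra hno => h.
  by apply/existsP; exists u; apply/existsP; exists c; rewrite u0.
have hM : (p %/ V * V <= p)%N := leq_trunc_div p V.
(* 126 n terms, at most p/8, are spent on the cubic phase. *)
pose n := (p %/ (126 * 8))%N.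
have hn : (n * (126 * 8) <= p)%N := leq_trunc_div p _.
have n0 : (0 < n)%N by rewrite divn_gt0 // (leq_trans V8) // ltnW.
(* p < 1008 (n + 1) <= 2016 n, and 2016 <= 2^11; cubing gives the factor 2^33. *)
have pn : (p <= 2 ^ 11 * n)%N.
  have : (p < n.+1 * (126 * 8))%N by apply: ltn_ceil.
  have : (126 * 8 * 2 <= 2 ^ 11)%N by [].
  move: (2 ^ 11)%N => k; nia.
apply: (@zero_sum_of_spread p V n 33) => //.
- by rewrite pV andbT; lia.
- by lia.
- by rewrite -[33%N]/(11 * 3)%N expnM -expnMn leq_exp2r.
- by move: hM; rewrite hV; lia.
Qed.

(** * Block decomposition for integer vectors *)

Definition int_zero_sum (J : Type) (I : finType) (n : J -> nat) (x : I -> J -> int)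
    (T : {set I}) : Prop :=
  forall j, (n j %| \sum_(i in T) x i j)%Z.

Definition forces_int (J : Type) (n : J -> nat) (t : nat) : Prop :=
  forall (I : finType) (x : I -> J -> int) (S : {set I}), (t <= #|S|)%N ->
  exists T : {set I}, [/\ T \subset S, T != set0 & int_zero_sum n x T].

Definition forces_short_int (J : Type) (n : J -> nat) (s t : nat) : Prop :=
  forall (I : finType) (x : I -> J -> int) (S : {set I}), (t <= #|S|)%N ->
  exists T : {set I}, [/\ T \subset S, T != set0, (#|T| <= s)%N & int_zero_sum n x T].

Definition block (I : finType) (S : {set I}) (lab : I -> nat) (b : nat) : {set I} :=
  [set i in S | lab i == b].

(** Blocks are encoded by a labelling, which makes them disjoint.  All but the last block
    have at most s terms; the last one is found by the weaker requirement t, which is what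
    makes the bound for the Davenport constant in rank two exact. *)
Lemma extract_blocks (I : finType) (P : {set I} -> Prop) (t s k : nat) (S : {set I}) :
  (forall S' : {set I}, (t <= #|S'|)%N -> exists T : {set I}, [/\ T \subset S', T != set0 & P T]) ->
  (forall S' : {set I}, (t + s <= #|S'|)%N ->
     exists T : {set I}, [/\ T \subset S', T != set0, (#|T| <= s)%N & P T]) ->
  (t + k * s <= #|S|)%N ->
  exists lab : I -> nat, forall b, (b <= k)%N -> block S lab b != set0 /\ P (block S lab b).
Proof.
move=> h0 h1.
have block0 (S' T : {set I}) (f : I -> nat) : T \subset S' ->
    block S' (fun i => if i \in T then 0 else (f i).+1)%N 0 = T.
  move=> TS; apply/setP => i; rewrite inE; case: (boolP (i \in T)) => iT.
    by rewrite (subsetP TS) // eqxx.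
  by rewrite andbF.
elim: k S => [|k IH] S hS.
  have [|T [TS T0 PT]] := h0 S; first by rewrite addn0 in hS.
  exists (fun i => if i \in T then 0 else 1)%N => b; rewrite leqn0 => /eqP ->.
  by rewrite (block0 S T (fun=> 0%N)).
have [|T [TS T0 cT PT]] := h1 S; first by apply: leq_trans hS; rewrite mulSn; lia.
have cS : (#|S :\: T| + #|T| = #|S|)%N.
  by rewrite cardsD (setIidPr TS) subnK // subset_leq_card.
have [|lab hlab] := IH (S :\: T); first by rewrite mulSn in hS; lia.
exists (fun i => if i \in T then 0 else (lab i).+1)%N => -[|b] bk; first by rewrite block0.
rewrite [block _ _ _](_ : _ = block (S :\: T) lab b); first exact: hlab.
by apply/setP => i; rewrite !inE; case: (i \in T); rewrite ?andbF ?eqSS.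
Qed.

Lemma big_blocks (R : Type) (idx : R) (op : Monoid.com_law idx) (I : finType) (k : nat)
    (S : {set I}) (lab : I -> nat) (T' : {set 'I_k}) (F : I -> R) :
  \big[op/idx]_(i in S | [exists b in T', lab i == b]) F i =
  \big[op/idx]_(b in T') \big[op/idx]_(i in block S lab b) F i.
Proof.
rewrite [RHS](exchange_big_dep (fun i => (i \in S) && [exists b in T', lab i == b])) /=.
  apply: eq_bigr => i /andP[iS /exists_inP[b bT /eqP ib]].
  rewrite (big_pred1 b) // => c /=; rewrite inE iS ib /=.
  by case: (eqVneq c b) => [->|cb]; rewrite ?bT ?eqxx // eq_sym (inj_eq val_inj) (negbTE cb) andbF.
move=> b i bT; rewrite inE => /andP[-> ib] /=.
by apply/exists_inP; exists b.
Qed.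

(** The block sums are divisible by n; a subfamily of blocks whose quotients sum to zero
    modulo m has a union that sums to zero modulo n m. *)
Lemma merge_blocks (J : Type) (I : finType) (n m N : J -> nat) (x : I -> J -> int)
    (S : {set I}) (k : nat) (lab : I -> nat) (T' : {set 'I_k}) :
  (forall j, N j = (n j * m j)%N) ->
  (forall b : 'I_k, block S lab b != set0 /\ int_zero_sum n x (block S lab b)) ->
  T' != set0 ->
  int_zero_sum m (fun (b : 'I_k) j => divz (\sum_(i in block S lab b) x i j) (n j)) T' ->
  exists T : {set I}, [/\ T \subset S, T != set0, int_zero_sum N x T &
    #|T| = (\sum_(b in T') #|block S lab b|)%N].
Proof.
move=> hN hb T0 hT'; exists [set i in S | [exists b in T', lab i == b]]; split.
- by apply/subsetP => i; rewrite inE => /andP[].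
- have [b bT] := set0Pn _ T0; have [/set0Pn[i]] := hb b.
  rewrite inE => /andP[iS ib] _; apply/set0Pn; exists i.
  by rewrite inE iS; apply/exists_inP; exists b.
- move=> j; under eq_bigl => i do rewrite inE.
  rewrite big_blocks hN PoszM.
  rewrite (eq_bigr (fun b : 'I_k => (n j)%:Z *
     divz (\sum_(i in block S lab b) x i j) (n j))) => [|b _]; last first.
    by rewrite mulrC divzK //; have [_] := hb b; apply.
  by rewrite -mulr_sumr dvdz_mul // hT'.
- rewrite -sum1_card; under eq_bigl => i do rewrite inE.
  by rewrite big_blocks; apply: eq_bigr => b _; rewrite sum1_card.
Qed.

Lemma forces_int_compose (J : Type) (n m N : J -> nat) (s t k : nat) :
  (forall j, N j = (n j * m j)%N) ->
  forces_int n t -> forces_short_int n s (t + s) -> forces_int m k.+1 ->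
  forces_int N (t + k * s).
Proof.
move=> hN h0 h1 h2 I x S hS.
have [lab hlab] := extract_blocks (h0 I x) (h1 I x) hS.
have [|T' [_ T0 hT']] := h2 'I_k.+1
  (fun b j => divz (\sum_(i in block S lab b) x i j) (n j)) setT.
  by rewrite cardsT card_ord.
have [b|T [TS Tn hT _]] := merge_blocks hN _ T0 hT'; first by apply: hlab; rewrite -ltnS.
by exists T.
Qed.

Lemma forces_short_int_compose (J : Type) (n m N : J -> nat) (s s' t k : nat) :
  (forall j, N j = (n j * m j)%N) ->
  forces_short_int n s t -> forces_short_int m s' k.+1 ->
  forces_short_int N (s * s') (t + k * s).
Proof.
move=> hN h1 h2 I x S hS.
have h0 (S' : {set I}) : (t <= #|S'|)%N ->
    exists T : {set I}, [/\ T \subset S', T != set0 & (#|T| <= s)%N /\ int_zero_sum n x T].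
  by move=> /(h1 I x)[T [? ? ? ?]]; exists T.
have h1' (S' : {set I}) : (t + s <= #|S'|)%N -> exists T : {set I},
    [/\ T \subset S', T != set0, (#|T| <= s)%N & (#|T| <= s)%N /\ int_zero_sum n x T].
  by move=> /(leq_trans (leq_addr _ _)) /(h1 I x)[T [? ? ? ?]]; exists T.
have [lab hlab] := extract_blocks h0 h1' hS.
have [|T' [_ T0 cT' hT']] := h2 'I_k.+1
  (fun b j => divz (\sum_(i in block S lab b) x i j) (n j)) setT.
  by rewrite cardsT card_ord.
have hb (b : 'I_k.+1) := hlab b (ltn_ord b).
have [b|T [TS Tn hT cT]] := merge_blocks hN _ T0 hT'; first by have [? []] := hb b.
exists T; split=> //; rewrite cT; apply: leq_trans (_ : \sum_(b in T') s <= _)%N.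
  by apply: leq_sum => b _; have [_ []] := hb b.
by rewrite sum_nat_const mulnC leq_mul2l cT' orbT.
Qed.

Lemma forces_intW (J : Type) (n : J -> nat) (s t : nat) :
  forces_short_int n s t -> forces_int n t.
Proof. by move=> h I x S /(h I x)[T [? ? _ ?]]; exists T. Qed.

Lemma leq_forces_int (J : Type) (n : J -> nat) (t u : nat) :
  (t <= u)%N -> forces_int n t -> forces_int n u.
Proof. by move=> tu h I x S uS; apply: h; apply: leq_trans uS. Qed.

Lemma leq_forces_short_int (J : Type) (n : J -> nat) (s t u : nat) :
  (t <= u)%N -> forces_short_int n s t -> forces_short_int n s u.
Proof. by move=> tu h I x S uS; apply: h; apply: leq_trans uS. Qed.

Lemma intr_Fp_eq0 (p : nat) (z : int) : prime p -> ((z%:~R : 'F_p) == 0) = (p %| z)%Z.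
Proof. by move=> pp; rewrite (dvdz_pcharf (pchar_Fp pp)). Qed.

Lemma sum_intr_Fp (p : nat) (I : finType) (x : I -> int) (T : {set I}) :
  prime p -> \sum_(i in T) (x i)%:~R = 0 :> 'F_p -> (p %| \sum_(i in T) x i)%Z.
Proof. by move=> pp h; rewrite -intr_Fp_eq0 // rmorph_sum /= h. Qed.

(** Induction on the number of prime factors.  For n = p m the blocks are zero-sum modulo
    p, and the bound C p + p f(m) is compatible with f(n) = (2C + 1) n - 2C: subtracting
    2C absorbs the term C p because p >= 2. *)
Lemma forces_short_int_cube : exists C : nat, forall n : nat, (0 < n)%N ->
  forces_short_int (fun _ : 'I_3 => n) n (C * n).
Proof.
have [C hC] := short_zero_sum_Fp3.
have base p : prime p -> forces_short_int (fun _ : 'I_3 => p) p (C * p).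
  move=> pp I x S hS; have [T [TS T0 cT hT]] := hC p pp I (fun i => \row_j (x i j)%:~R) S hS.
  exists T; split=> // j; apply: sum_intr_Fp => //.
  by have /rowP/(_ j) := hT; rewrite summxE [RHS]mxE => h; rewrite -[RHS]h;
    apply: eq_bigr => i _; rewrite mxE.
exists (2 * C + 1)%N => n n0; apply: (@leq_forces_short_int _ _ _ ((2 * C + 1) * n - 2 * C)).
  exact: leq_subr.
elim/ltn_ind: n n0 => n IH n0.
case: (leqP n 1) => n1.
  have -> : n = 1%N by lia.
  move=> I x S hS; have [i iS] : exists i, i \in S by apply/set0Pn; rewrite -card_gt0; lia.
  exists [set i]; split; rewrite ?sub1set ?cards1 //; by apply/set0Pn; exists i; rewrite set11.
have pp := pdiv_prime n1; have [m nE] := dvdnP (pdiv_dvd n).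
set p := pdiv n in pp nE; have p1 := prime_gt1 pp.
have m0 : (0 < m)%N by nia.
have mn : (m < n)%N by nia.
have := IH m mn m0; have -> : ((2 * C + 1) * m - 2 * C)%N = ((2 * C + 1) * m - 2 * C).-1.+1.
  by nia.
move=> /(forces_short_int_compose (fun _ => erefl) (base p pp)).
rewrite mulnC -nE; apply: leq_forces_short_int.
by nia.
Qed.

(** Indexing by booleans treats cyclic groups (first modulus 1) and groups of rank two
    alike. *)
Definition pair_moduli (a b : nat) (c : bool) : nat := if c then a else b.

(** Blocks of length at most p, for a prime p dividing n, are found among any p terms. *)
Lemma forces_int_cyclic (n : nat) : (0 < n)%N -> forces_int (pair_moduli 1 n) n.
Proof.
elim/ltn_ind: n => n IH n0; case: (leqP n 1) => n1.
  have -> : n = 1%N by lia.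
  move=> I x S hS; have [i iS] : exists i, i \in S by apply/set0Pn; rewrite -card_gt0.
  exists [set i]; split; rewrite ?sub1set //; first by apply/set0Pn; exists i; rewrite set11.
  by case; rewrite dvdzE dvd1n.
have pp := pdiv_prime n1; have [m nE] := dvdnP (pdiv_dvd n).
set p := pdiv n in pp nE; have p1 := prime_gt1 pp.
have m0 : (0 < m)%N by nia.
have mn : (m < n)%N by nia.
have base : forces_short_int (pair_moduli 1 p) p p.
  move=> I x S hS; have [S' S'S cS'] := subset_of_card hS.
  have [|T [TS T0 hT]] := davenport_Fp (fun (_ : unit) i => (x i false)%:~R) (S := S') pp.
    by rewrite card_unit cS'; lia.
  exists T; split=> //; first exact: subset_trans S'S.
    by rewrite -cS' subset_leq_card.
  by case; [rewrite dvdzE dvd1n|apply: sum_intr_Fp => //; apply: hT tt].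
have hN c : pair_moduli 1 n c = (pair_moduli 1 p c * pair_moduli 1 m c)%N.
  by case: c => //=; rewrite mulnC.
have hm : forces_int (pair_moduli 1 m) m.-1.+1 by rewrite prednK //; apply: IH.
have := forces_int_compose hN (forces_intW base) (leq_forces_short_int (leq_addr p p) base) hm.
by apply: leq_forces_int; nia.
Qed.

(** Olson's theorem on groups of rank two.  With n = p q one needs q + q m - 1 blocks, all
    but the last of length at most p: this requires 2p - 1 + p (q + q m - 2), that is
    n + n m - 1 terms, and 3p - 2 terms are still available for each short block. *)
Lemma forces_int_rank2 (n m : nat) : (0 < n)%N -> (0 < m)%N ->
  forces_int (pair_moduli n (n * m)) (n + n * m - 1).
Proof.
move=> + m0; elim/ltn_ind: n => n IH n0; case: (leqP n 1) => n1.
  have -> : n = 1%N by lia.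
  by rewrite mul1n add1n subn1; apply: forces_int_cyclic.
have pp := pdiv_prime n1; have [q nE] := dvdnP (pdiv_dvd n).
set p := pdiv n in pp nE; have p1 := prime_gt1 pp.
have q0 : (0 < q)%N by nia.
have qn : (q < n)%N by nia.
have base : forces_int (pair_moduli p p) (2 * p - 1).
  move=> I x S hS.
  have [|T [TS T0 hx hy]] := davenport_plane (fun i => (x i true)%:~R)
    (fun i => (x i false)%:~R) (S := S) pp; first by lia.
  by exists T; split=> //; case; apply: sum_intr_Fp.
have short : forces_short_int (pair_moduli p p) p (2 * p - 1 + p).
  move=> I x S hS.
  have [|T [TS T0 cT hx hy]] := eta_plane (fun i => (x i true)%:~R)
    (fun i => (x i false)%:~R) (S := S) pp; first by lia.
  by exists T; split=> //; case; apply: sum_intr_Fp.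
have hN c : pair_moduli n (n * m) c = (pair_moduli p p c * pair_moduli q (q * m) c)%N.
  by case: c; rewrite /= nE; lia.
have hq := IH q qn q0.
have e : (q + q * m - 1 = (q + q * m - 2).+1)%N by nia.
rewrite e in hq; have := forces_int_compose hN base short hq.
by apply: leq_forces_int; rewrite nE; nia.
Qed.

Definition triple_moduli (a b c : nat) (j : 'I_3) : nat := nth 0%N [:: a; b; c] j.

Lemma forces_int_rank3 : exists K : nat, forall a1 a2 a3 : nat,
  (0 < a1)%N -> (0 < a2)%N -> (0 < a3)%N ->
  forces_int (triple_moduli a1 (a1 * a2) (a1 * a2 * a3))
    (a1 * a2 * a3 + a1 * a2 + K * a1).
Proof.
have [C hC] := forces_short_int_cube; exists C => a1 a2 a3 h1 h2 h3.
have hm : forces_int (triple_moduli 1 a2 (a2 * a3)) (a2 + a2 * a3 - 1).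
  move=> I x S hS; pose o1 : 'I_3 := Ordinal (isT : 1 < 3)%N.
  pose o2 : 'I_3 := Ordinal (isT : 2 < 3)%N.
  have [T [TS T0 hT]] := forces_int_rank2 h2 h3
    (fun i (c : bool) => x i (if c then o1 else o2)) hS.
  exists T; split=> // -[[|[|[|//]]] hj].
  - by rewrite dvdzE dvd1n.
  - by rewrite (bool_irrelevance hj isT); apply: (hT true).
  - by rewrite (bool_irrelevance hj isT); apply: (hT false).
have hN j : triple_moduli a1 (a1 * a2) (a1 * a2 * a3) j
    = (a1 * triple_moduli 1 a2 (a2 * a3) j)%N.
  by case: j => [[|[|[|//]]] hj]; rewrite /triple_moduli /= ?muln1 ?mulnA.
have e : (a2 + a2 * a3 - 1 = (a2 + a2 * a3 - 2).+1)%N by nia.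
rewrite e in hm.
have hs := hC a1 h1.
have := forces_int_compose hN (forces_intW hs) (leq_forces_short_int (leq_addr _ _) hs) hm.
apply: leq_forces_int.
have : (a2 + a2 * a3 - 2 <= a2 + a2 * a3)%N by lia.
by nia.
Qed.

(** * Finite abelian groups of rank three *)

(** Here 'Z_1 has two elements but Zp 1 is trivial, so the case a = 1 is apart. *)
Lemma Zp_sum_eq0 (a : nat) (I : finType) (g : I -> 'Z_a) (T : {set I}) :
  (0 < a)%N -> (forall i, g i \in Zp a) -> (a %| \sum_(i in T) (g i : nat)%:Z)%Z ->
  \sum_(i in T) g i = 0.
Proof.
move=> a0 hg; case: (leqP a 1) => a1 hT.
  have ea : a = 1%N by lia.
  rewrite big1 // => i _; have := hg i; rewrite /Zp ltnNge a1 /= => /set1P -> //.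
rewrite (eq_bigr (fun i => (g i : nat)%:R)) => [|i _]; last by rewrite natr_Zp.
rewrite -natr_sum; move: hT; rewrite -(big_morph Posz PoszD erefl) dvdzE /= => /dvdnP[q ->].
by rewrite natrM pchar_Zp // mulr0.
Qed.

Lemma forces_zero_sum_isog (G : finZmodType) (a b c t : nat) :
  (0 < a)%N -> (0 < b)%N -> (0 < c)%N -> isog_cyclic3 G a b c ->
  forces_int (triple_moduli a b c) t -> forces_zero_sum G t.
Proof.
move=> a0 b0 c0 /isogP[f injf imf] ht; apply/forallP => x; apply/existsP.
have fE u : f u \in setX (setX (Zp a) (Zp b)) (Zp c).
  by rewrite -imf; apply: mem_morphim; rewrite inE.
have f1 u : (f u).1.1 \in Zp a by have := fE u; rewrite !inE => /andP[/andP[]].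
have f2 u : (f u).1.2 \in Zp b by have := fE u; rewrite !inE => /andP[/andP[]].
have f3 u : (f u).2 \in Zp c by have := fE u; rewrite !inE => /andP[].
have fD u v : f (u + v) = (f u * f v)%g by rewrite -morphM ?inE.
have f0 : f 0 = 1%g by rewrite -(morph1 f).
have [|T [_ T0 hT]] := ht 'I_t (fun i j =>
  (nth 0%N [:: (f (x i)).1.1 : nat; (f (x i)).1.2 : nat; (f (x i)).2 : nat] j)%:Z) setT.
  by rewrite cardsT card_ord.
exists T; rewrite /zero_sum_at T0 /=.
have inj u : f u = 1%g -> u = 0.
  by move=> fu; apply: (injmP injf); rewrite ?inE // fu f0.
apply/eqP/inj; rewrite [f _]surjective_pairing [(f _).1]surjective_pairing.
have -> : (f (\sum_(i in T) x i)).1.1 = \sum_(i in T) (f (x i)).1.1.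
  by apply: (big_morph (fun u => (f u).1.1)) => [u v|]; rewrite ?fD ?f0.
have -> : (f (\sum_(i in T) x i)).1.2 = \sum_(i in T) (f (x i)).1.2.
  by apply: (big_morph (fun u => (f u).1.2)) => [u v|]; rewrite ?fD ?f0.
have -> : (f (\sum_(i in T) x i)).2 = \sum_(i in T) (f (x i)).2.
  by apply: (big_morph (fun u => (f u).2)) => [u v|]; rewrite ?fD ?f0.
rewrite (Zp_sum_eq0 a0) ?(Zp_sum_eq0 b0) ?(Zp_sum_eq0 c0) //.
- exact: (hT (Ordinal (isT : 2 < 3)%N)).
- exact: (hT (Ordinal (isT : 1 < 3)%N)).
- exact: (hT (Ordinal (isT : 0 < 3)%N)).
Qed.

Lemma davenport_leq (G : finZmodType) (t : nat) : forces_zero_sum G t -> (davenport G <= t)%N.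
Proof. by rewrite /davenport; case: ex_minnP => m _; apply. Qed.

Lemma alon_dubiner_exists (R : realType) : exists c : R, alon_dubiner_constant 3 c.
Proof.
have [C hC] := short_zero_sum_Fp3; exists C%:R => p pp.
have h : forces_short_zero_sum 'rV['F_p]_3 p (C * p).
  apply/forallP => x; apply/existsP.
  have [|T [_ T0 cT hT]] := hC p pp _ x setT; first by rewrite cardsT card_ord.
  by exists T; rewrite /zero_sum_at T0 hT eqxx.
have ex : exists t, forces_short_zero_sum 'rV['F_p]_3 p t by exists (C * p)%N.
exists (ex_minn ex); case: ex_minnP => m hm min.
  by split.
by rewrite -natrM ler_nat min.
Qed.

(** At p = 2 the threshold is at least 1, since the empty sequence has no nonempty
    subsequence. *)
Lemma alon_dubiner_constant_ge (R : realType) (c : R) :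
  alon_dubiner_constant 3 c -> 1 <= 2 * c.
Proof.
move=> /(_ 2 isT)[t [ht _] htc]; rewrite mulrC; apply: le_trans htc.
rewrite ler1n lt0n; apply/negP => /eqP t0; move: ht; rewrite t0.
move=> /forallP/(_ [ffun=> 0])/existsP[I /andP[/andP[/set0Pn[[i hi]]]]].
by move: (hi).
Qed.

Theorem theorem2 (R : realType) :
  (exists c : R, alon_dubiner_constant 3 c) /\
  exists m M : R,
    [/\ 0 < m, 0 < M &
      forall c : R, alon_dubiner_constant 3 c ->
      exists K : R,
        [/\ m * c <= K, K <= M * c &
          forall (a1 a2 a3 : nat) (G : finZmodType),
            (0 < a1)%N -> (0 < a2)%N -> (0 < a3)%N ->
            isog_cyclic3 G a1 (a1 * a2) (a1 * a2 * a3) ->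
            (davenport G)%:R <= (a1 * a2 * a3)%:R + (a1 * a2)%:R + K * a1%:R]].
Proof.
split; first exact: alon_dubiner_exists.
have [K hK] := forces_int_rank3.
exists (2 * K.+1%:R), (2 * K.+1%:R).
have K0 : 0 < 2 * K.+1%:R :> R by rewrite mulr_gt0.
split=> // c hc; exists (2 * K.+1%:R * c); split=> // a1 a2 a3 G h1 h2 h3 hG.
have h12 : (0 < a1 * a2)%N by rewrite muln_gt0 h1.
have h123 : (0 < a1 * a2 * a3)%N by rewrite muln_gt0 h12.
have := davenport_leq (forces_zero_sum_isog h1 h12 h123 hG (hK a1 a2 a3 h1 h2 h3)).
rewrite -(ler_nat R) => /le_trans; apply; rewrite !natrD lerD2l natrM.
rewrite ler_wpM2r // mulrAC; have hc1 := alon_dubiner_constant_ge hc.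
apply: le_trans (_ : K.+1%:R <= _); first by rewrite ler_nat.
by rewrite -[X in X <= _]mul1r ler_wpM2r.
Qed.
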